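(* Let $f=\sum_{i=0}^n x_i^{m_i}$ with $m_i\ge2$, let $F=f+\sum_{\nu\in\Gamma}x^\nu s_\nu$ with $\Gamma=\mathbb N^{n+1}\cap\prod_{i=0}^n[0,m_i-2]$, and let $\zeta_S$ be the primitive form associated with the canonical good section $\sigma_0$ and with the class of $\omega_0=dx_0\wedge\cdots\wedge dx_n$. Let $k$ be a positive integer. Then the image $\zeta_{S,k}$ of $\zeta_S$ in $H''_{F,S}/\mathfrak m_0^{k+1}H''_{F,S}$ is $$\zeta_{S,k}=\sum_{a\in A'_k}c_a\,\partial_t^{-e_a}\bigl[x^{r(a)}s^a\omega_0\bigr]_F ,$$ where the $c_a\in\mathbb C$ ($a\in A'_k$) are determined inductively by $c_0=1$ and, for $a\in A'_k\setminus\{0\}$, $$c_a=-\sum_{b\in A'_k,\;0\le b<a}\left((-1)^{|a-b|}\,\frac{c_b}{(a-b)!}\,\prod_{i=0}^n\ \prod_{k_i=1}^{q(a,b)_i}\frac{r(b)_i+p(a-b)_i-k_im_i+1}{m_i}\right),\qquad q(a,b)_i:=\left\lfloor\frac{r(b)_i+p(a-b)_i}{m_i}\right\rfloor .$$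
   Context: Combinatorial notation. For $a=(a_\nu)\in\mathbb N^\Gamma$: $|a|:=\sum_\nu a_\nu$, $a!:=\prod_\nu a_\nu!$, $s^a:=\prod_\nu s_\nu^{a_\nu}$, $p(a)_i:=\sum_{\nu\in\Gamma}\nu_ia_\nu$ ($0\le i\le n$). Write $p(a)_i=q(a)_im_i+r(a)_i$ with $q(a)_i,r(a)_i\in\mathbb N$ and $0\le r(a)_i<m_i$, so $q(a),r(a)\in\mathbb N^{n+1}$. Put $e_a:=\sum_{i=0}^nq(a)_i-|a|$, $A_k:=\{a\in\mathbb N^\Gamma: |a|\le k\}$ and $A'_k:=\{a\in A_k: e_a\ge0,\ r(a)\in\Gamma\}$. $b\le a$ means $b_\nu\le a_\nu$ for all $\nu$, and $b<a$ means $b\le a$, $b\ne a$. Also $x^\nu:=\prod_ix_i^{\nu_i}$; empty products are $1$. Gauss-Manin systems. $X$ is a neighbourhood of $0$ in $\mathbb C^{n+1}$, $S$ a neighbourhood of $0$ in $\mathbb C^\mu$ with coordinates $\mathbf s=(s_\nu)_{\nu\in\Gamma}$, $\mu=\#\Gamma=\prod_i(m_i-1)$, $Y=X\times S$, $\mathfrak m_0$ the maximal ideal of $\mathbb C\{\mathbf s\}=\mathcal O_{S,0}$, $u=\partial_t^{-1}$. For local coordinates $y$, $\mathbb C\{y\}\{\!\{u\}\!\}$ is the ring of $\sum a_{\nu,k}y^\nu u^k\in\mathbb C[[y,u]]$ with $\sum|a_{\nu,k}|\,r^{|\nu|+k}/k!<\infty$ for some $r>0$, and $\Omega^\bullet_{Y/S,0}\{\!\{u\}\!\}$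 is the complex of relative forms with coefficients in this ring, $d$ being the relative differential (in $x$). Put $$G_{F,S}:=H^{n+1}\bigl(\Omega^\bullet_{Y/S,0}\{\!\{u\}\!\}[u^{-1}],ud-dF\wedge\bigr),\qquad H''_{F,S}:=H^{n+1}\bigl(\Omega^\bullet_{Y/S,0}\{\!\{u\}\!\},ud-dF\wedge\bigr)\subset G_{F,S};$$ $G_f$, $H''_f$ are defined in the same way with no parameters $\mathbf s$ and with $f$ instead of $F$, and $H''_{F,S}/\mathfrak m_0H''_{F,S}=H''_f$. $[\eta]_F$ denotes the class of $\eta\in\Omega^{n+1}_{Y/S}$ in $H''_{F,S}$ (mod $\mathfrak m_0^{k+1}$), and $[\omega]$ the class of $\omega\in\Omega^{n+1}_{X,0}$ in $H''_f$. The actions are $t[\omega]=[F\omega+u^2\partial_u\omega]$ and $\partial_{s_\nu}[\omega]_F=[\partial_{s_\nu}\omega-u^{-1}(\partial F/\partial s_\nu)\omega]_F$ (with $F$ replaced by $f$ for $t$ on $G_f$). Let $\Omega_f=\Omega^{n+1}_{X,0}/df\wedge\Omega^n_{X,0}\cong H''_f/uH''_f$ and $\Omega_{F,S}=\Omega^{n+1}_{Y/S,0}/dF\wedge\Omega^n_{Y/S,0}\cong H''_{F,S}/uH''_{F,S}$. Primitive form. The canonical good section $\sigma_0:\Omega_f\to H''_f$ is the $\mathbb C$-linear section of the projection with image $I_0=\sum_{\nu\in\Gamma}\mathbb C[x^\nu\omega_0]$; it satisfies $tI_0\subset I_0+uI_0$. By Malgrange it extends uniquely to a $\mathbb C\{\mathbf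 s\}$-linear section $\sigma_S:\Omega_{F,S}\to H''_{F,S}$ whose image $I_S$ satisfies $tI_S\subset I_S+uI_S$ and $\partial_{s_\nu}I_S\subset I_S+u^{-1}I_S$ for all $\nu$. There is a unique $\mathbb C$-linear lift $\sigma_S^\nabla:\Omega_f\to H''_{F,S}$ of $\sigma_0$ with $\mathrm{Im}\,\sigma_S^\nabla\subset I_S$ and $\partial_{s_\nu}(\mathrm{Im}\,\sigma_S^\nabla)\subset\partial_t I_S$ for all $\nu$. The primitive form is $\zeta_S:=\sigma_S^\nabla(\overline\zeta_0)\in H''_{F,S}$, where $\overline\zeta_0\in\Omega_f$ is the class of $\omega_0$ (so $\zeta_S$ restricts to $[\omega_0]$ at $\mathbf s=0$). *)

(* Defs.v *)
From HB Require Import structures.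
From mathcomp Require Import all_boot all_order all_algebra.
From mathcomp Require Import complex generic_quotient ring_quotient ring zify.
From mathcomp Require Import all_classical all_reals ereal esum.

Set Implicit Arguments.
Unset Strict Implicit.
Unset Printing Implicit Defensive.

Import Order.TTheory GRing.Theory Num.Theory.
Local Open Scope ring_scope.
Local Open Scope quotient_scope.

Definition mexp (Y : finType) := {ffun Y -> nat}.

Section Exponents.
Context {Y : finType}.
Implicit Types a b : mexp Y.

Definition edeg a : nat := (\sum_y a y)%N.
Definition efact a : nat := (\prod_y (a y)`!)%N.
Definition ele b a : bool := [forall y, b y <= a y]%N.
Definition elt b a : bool := ele b a && (b != a).
Definition esub a b : mexp Y := [ffun y => a y - b y]%N.
Definition eadd a b : mexp Y := [ffun y => a y + b y]%N.
Definition eunit (y : Y) : mexp Y := [ffun z => (z == y) : nat].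
Definition ezero : mexp Y := [ffun=> 0%N].

(* The exponents with all entries at most [k]; in particular every [a] with
   [edeg a <= k] is [bval] of exactly one element of this finite type. *)
Definition bexp (k : nat) := {ffun Y -> 'I_k.+1}.
Definition bval k (b : bexp k) : mexp Y := [ffun y => b y : nat].

Lemma ele_edeg b a : ele b a -> (edeg b + edeg (esub a b) = edeg a)%N.
Proof.
move/forallP=> le_ba; rewrite /edeg -big_split; apply: eq_bigr => y _ /=.
by rewrite ffunE subnKC.
Qed.

Lemma leq_edeg a y : (a y <= edeg a)%N.
Proof. by rewrite /edeg (bigD1 y) //= leq_addr. Qed.

Lemma edeg_eadd a b : edeg (eadd a b) = (edeg a + edeg b)%N.
Proof. by rewrite /edeg -big_split; apply: eq_bigr => y _; rewrite ffunE. Qed.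

Lemma edeg_eunit y : edeg (eunit y) = 1%N.
Proof.
rewrite /edeg (bigD1 y) //= ffunE eqxx big1 ?addn0 // => z zy.
by rewrite ffunE (negPf zy).
Qed.

Lemma bval_inj k : injective (@bval k).
Proof.
move=> b c /ffunP bc; apply/ffunP => y; apply/val_inj.
by have := bc y; rewrite !ffunE.
Qed.

End Exponents.

Section Convergence.
Context {R : realType} {Y : finType}.
Local Notation C := R[i].
Local Notation fps := (mexp Y -> C).
(* [g a j] is the coefficient of y^a u^j. *)
Local Notation flaurent := (mexp Y -> int -> C).
Implicit Types (h : fps) (g : flaurent) (a b : mexp Y) (j : int) (y : Y).

Definition convergent h : Prop :=
  exists2 r : R, 0 < r &
    (\esum_(a in [set: mexp Y]) (Normc.normc (h a) * r ^+ edeg a)%:E < +oo)%E.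

Definition gevrey g : Prop :=
  (forall a j, j < 0 -> g a j = 0) /\
  exists2 r : R, 0 < r &
    (\esum_(p in [set: mexp Y * nat])
       (Normc.normc (g p.1 p.2%:Z) * r ^+ (edeg p.1 + p.2) / p.2`!%:R)%:E < +oo)%E.

(* multiplication by u^e *)
Definition ushift (e : int) g : flaurent := fun a j => g a (j - e).

Definition gevrey_laurent g : Prop := exists N : nat, gevrey (ushift N%:Z g).

(* Cauchy product and partial derivatives; on Laurent series in u they act on
   the coefficient of each power of u. *)
Definition cmul h h' : fps := fun a =>
  \sum_(b : bexp (edeg a) | ele (bval b) a) h (bval b) * h' (esub a (bval b)).
Definition cder y h : fps := fun a => (a y).+1%:R * h (eadd a (eunit y)).
Definition lmul h g : flaurent := fun a j => cmul h (g^~ j) a.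
Definition lder y g : flaurent := fun a j => cder y (g^~ j) a.

(* u^2 d/du *)
Definition u2du g : flaurent := fun a j => (j - 1)%:~R * g a (j - 1).

Definition cmono (e : mexp Y) : fps := fun a => (a == e)%:R.
(* the inclusion of C[[y]] as the series without u *)
Definition cincl h : flaurent := fun a j => if j == 0 then h a else 0.
Definition cproj g : fps := fun a => g a 0.

End Convergence.

Section ConvergenceFacts.
Context {R : realType}.
Local Notation C := R[i].
Local Notation norm := (@Normc.normc R).

Lemma normc_ge0 (z : C) : 0 <= norm z.
Proof. by case: z => x y; apply: sqrtr_ge0. Qed.

Lemma normc_sum (I : Type) (s : seq I) (P : pred I) (F : I -> C) :
  norm (\sum_(i <- s | P i) F i) <= \sum_(i <- s | P i) norm (F i).
Proof.
elim/big_rec2: _ => [|i y x _ le_xy]; first by rewrite Normc.normc0.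
by apply: le_trans (le_normcD _ _) _; rewrite lerD2l.
Qed.

Lemma normc_nat (k : nat) : norm k%:R = k%:R.
Proof.
by rewrite -[k%:R in LHS](rmorph_nat (real_complex R)) /= expr0n addr0
  sqrtr_sqr ger0_norm.
Qed.

Lemma summable_bound (T : choiceType) (D : T -> nat) (w : T -> R) (K : R) :
    (forall t, 0 <= w t) ->
    (forall s : seq T, uniq s -> \sum_(t <- s) (2^-1) ^+ D t <= K) ->
  (exists2 r : R, 0 < r &
     (\esum_(t in [set: T]) (w t * r ^+ D t)%:E < +oo)%E) <->
  (exists r M : R, [/\ 0 < r, 0 <= M & forall t, w t * r ^+ D t <= M]).
Proof.
move=> w0 HK; split; [case=> r r0 fin|case=> r [M [r0 M0 HM]]].
  have t0 t : 0 <= w t * r ^+ D t by apply: mulr_ge0 => //; rewrite exprn_ge0 // ltW.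
  have e0 : (0 <= \esum_(t in [set: T]) (w t * r ^+ D t)%:E)%E.
    by apply: esum_ge0 => t _; rewrite lee_fin.
  set S := esum _ _ in fin e0.
  have Sfin : S \is a fin_num by rewrite ge0_fin_numE.
  exists r, (fine S); split=> // [|t]; first exact: fine_ge0.
  rewrite -lee_fin fineK //; apply: esum_ge; exists [set t]%classic.
    by split=> //; exact: finite_set1.
  by rewrite fsbig_set1.
exists (r / 2); first by rewrite divr_gt0.
apply: (@le_lt_trans _ _ (M * K)%:E); last by rewrite ltry.
apply: ub_ereal_sup => _ [A [Afin _] <-].
rewrite fsbig_finite //= sumEFin lee_fin.
apply: (@le_trans _ _ (\sum_(t <- finmap.enum_fset (fset_set A)) M * (2^-1) ^+ D t)).
  apply: ler_sum => t _; rewrite exprMn mulrA ler_wpM2r ?exprn_ge0 //.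
by rewrite -mulr_sumr ler_wpM2l // HK // finmap.fset_uniq.
Qed.

Lemma ler_sum_subseq (T : eqType) (s s' : seq T) (F : T -> R) :
    (forall t, 0 <= F t) -> uniq s -> uniq s' -> {subset s <= s'} ->
  \sum_(t <- s) F t <= \sum_(t <- s') F t.
Proof.
move=> F0 us us' ss'; rewrite (bigID (mem s)) /= [leRHS](bigID (mem s)) /=.
rewrite [X in _ + X]big_seq_cond [X in _ + X]big1 ?addr0; last first.
  by move=> t /andP[->].
rewrite -[X in X <= _]addr0 lerD ?sumr_ge0 //.
rewrite -[leLHS]big_filter -[leRHS]big_filter (perm_big [seq t <- s' | t \in s]) //.
apply: uniq_perm; rewrite ?filter_uniq // => t; rewrite !mem_filter andbb.
by case ts: (t \in s) => //=; rewrite ss'.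
Qed.

Lemma geom_half (N : nat) : \sum_(k < N) (2^-1 : R) ^+ k <= 2.
Proof.
have -> : \sum_(k < N) (2^-1 : R) ^+ k = 2 - 2 * 2^-1 ^+ N.
  elim: N => [|N IH]; first by rewrite big_ord0 expr0 mulr1 subrr.
  by rewrite big_ord_recr /= IH exprS; field.
by rewrite lerBlDr lerDl mulr_ge0 ?exprn_ge0 ?invr_ge0.
Qed.

Section Bounds.
Context {Y : finType}.

Lemma half_sum2 (s : seq (mexp Y * nat)) : uniq s ->
  \sum_(t <- s) (2^-1 : R) ^+ (edeg t.1 + t.2) <= 2 ^+ #|Y| * 2.
Proof.
move=> us; pose N := \max_(t <- s) (edeg t.1 + t.2)%N.
pose e (t : {ffun Y -> 'I_N.+1} * 'I_N.+1) : mexp Y * nat := (bval t.1, t.2 : nat).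
have einj : injective e by move=> [a k] [b l] [] /bval_inj -> /val_inj ->.
apply: (@le_trans _ _ (\sum_(t <- map e (enum {: {ffun Y -> 'I_N.+1} * 'I_N.+1}))
    (2^-1 : R) ^+ (edeg t.1 + t.2))).
  apply: ler_sum_subseq => //.
  - by rewrite map_inj_uniq ?enum_uniq.
  - move=> [a k] ts; have le_N : (edeg a + k <= N)%N.
      by rewrite /N (big_rem _ ts) leq_maxl.
    have aN y : (a y < N.+1)%N.
      by rewrite ltnS (leq_trans (leq_edeg a y)) // (leq_trans _ le_N) ?leq_addr.
    have kN : (k < N.+1)%N by rewrite ltnS (leq_trans _ le_N) ?leq_addl.
    apply/mapP; exists ([ffun y => Ordinal (aN y)], Ordinal kN).
      by rewrite mem_enum.
    by congr pair; apply/ffunP => y; rewrite !ffunE.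
rewrite big_map big_enum /=.
rewrite -(pair_bigA _ (fun a k => (2^-1 : R) ^+ (edeg (bval a) + nat_of_ord k))) /=.
under eq_bigr => a _.
  under eq_bigr => k _ do rewrite exprD.
  rewrite -mulr_sumr; over.
rewrite -mulr_suml ler_pM ?geom_half ?sumr_ge0 //.
have -> : \sum_(a : {ffun Y -> 'I_N.+1}) (2^-1 : R) ^+ edeg (bval a)
        = \prod_(y : Y) \sum_(k < N.+1) (2^-1 : R) ^+ k.
  rewrite bigA_distr_bigA; apply: eq_bigr => a _.
  rewrite /edeg -prodrXr; apply: eq_bigr => y _; by rewrite ffunE.
rewrite prodr_const; apply: lerXn2r; rewrite ?nnegrE ?sumr_ge0 ?geom_half //.
Qed.

Lemma half_sum1 (s : seq (mexp Y)) : uniq s ->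
  \sum_(t <- s) (2^-1 : R) ^+ edeg t <= 2 ^+ #|Y| * 2.
Proof.
move=> us; have := @half_sum2 [seq (a, 0%N) | a <- s]; rewrite map_inj_uniq //.
  by rewrite big_map /=; under eq_bigr do rewrite addn0; apply.
by move=> a b [].
Qed.

Lemma convergentP (h : mexp Y -> C) : convergent h <->
  exists r M : R, [/\ 0 < r, 0 <= M & forall a, norm (h a) * r ^+ edeg a <= M].
Proof.
by apply: summable_bound half_sum1 => a; apply: normc_ge0.
Qed.

Lemma gevreyP (g : mexp Y -> int -> C) : gevrey g <->
  (forall a j, j < 0 -> g a j = 0) /\
  exists r M : R, [/\ 0 < r, 0 <= M &
    forall a (k : nat), norm (g a k) * r ^+ (edeg a + k) <= M * k`!%:R].
Proof.
have /= H := @summable_bound (mexp Y * nat)%type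
  (fun p => (edeg p.1 + p.2)%N) (fun p => norm (g p.1 p.2) / p.2`!%:R) _ _ half_sum2.
have fpos (k : nat) : 0 < k`!%:R :> R by rewrite ltr0n fact_gt0.
have {}H := H (fun p => divr_ge0 (normc_ge0 _) (ltW (fpos _))).
split=> -[g0 Hg]; split=> //.
  have [r [M [r0 M0 HM]]] : exists r M : R, [/\ 0 < r, 0 <= M &
      forall t : mexp Y * nat,
        norm (g t.1 t.2) / t.2`!%:R * r ^+ (edeg t.1 + t.2) <= M].
    apply/H; case: Hg => r r0 fin; exists r => //; congr (_ < _)%E: fin.
    by apply: eq_esum => p _; rewrite mulrAC.
  exists r, M; split=> // a k; have := HM (a, k) => /=.
  by rewrite mulrAC ler_pdivrMr.
case: Hg => r [M [r0 M0 HM]].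
have [|r' r'0 fin] := H.2 _.
  by exists r, M; split=> // -[a k] /=; rewrite mulrAC ler_pdivrMr.
exists r' => //; congr (_ < _)%E: fin.
by apply: eq_esum => p _; rewrite mulrAC.
Qed.

End Bounds.
End ConvergenceFacts.

Section Closure.
Context {R : realType} {Y : finType}.
Local Notation C := R[i].
Local Notation norm := (@Normc.normc R).
Local Notation fps := (mexp Y -> C).
Local Notation flaurent := (mexp Y -> int -> C).
Implicit Types (h : fps) (g : flaurent) (a b e : mexp Y) (y : Y).

Lemma expr_min (r r' : R) (k : nat) (x M : R) : 0 < r' -> r' <= r -> 0 <= x ->
  x * r ^+ k <= M -> x * r' ^+ k <= M.
Proof.
move=> r'0 le_r x0; apply: le_trans; rewrite ler_wpM2l //.
by rewrite lerXn2r ?nnegrE // ltW // (lt_le_trans r'0).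
Qed.

Lemma expr_half (r : R) (k : nat) : (r / 2) ^+ k = r ^+ k * 2^-1 ^+ k.
Proof. by rewrite exprMn. Qed.

Lemma nat_half (k l : nat) : (k <= l)%N -> (k.+1)%:R * (2^-1 : R) ^+ l <= 1.
Proof.
move=> kl; rewrite exprVn ler_pdivrMr ?exprn_gt0 // mul1r -natrX ler_nat.
by rewrite (leq_ltn_trans kl) // ltn_expl.
Qed.

Lemma cincl_gevrey h : gevrey (cincl h) <-> convergent h.
Proof.
rewrite gevreyP convergentP; split=> [[_ [r [M [r0 M0 HM]]]]|[r [M [r0 M0 HM]]]].
  exists r, M; split=> // a; have := HM a 0%N.
  by rewrite /cincl eqxx addn0 fact0 mulr1.
split; first by move=> a j j0; rewrite /cincl lt_eqF.
exists r, M; split=> // a [|k]; first by rewrite /cincl eqxx addn0 mulr1.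
by have -> : cincl h a k.+1 = 0 by []; rewrite Normc.normc0 mul0r mulr_ge0.
Qed.

Lemma gevrey0 : gevrey (0 : flaurent).
Proof.
apply/gevreyP; split=> //; exists 1, 0; split=> // a k.
by have -> : (0 : flaurent) a k = 0 by []; rewrite Normc.normc0 !mul0r.
Qed.

Lemma gevreyD (c : C) g g' : gevrey g -> gevrey g' -> gevrey (c *: g + g').
Proof.
move=> /gevreyP[g0 [r [M [r0 M0 HM]]]] /gevreyP[g'0 [r' [M' [r'0 M'0 HM']]]].
apply/gevreyP; split=> [a j j0|].
  have -> : (c *: g + g') a j = c * g a j + g' a j by [].
  by rewrite g0 // g'0 // mulr0 addr0.
have m0 : 0 < Num.min r r' by rewrite lt_min r0.
exists (Num.min r r'), (norm c * M + M'); split=> //.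
  by rewrite addr_ge0 // mulr_ge0 ?normc_ge0.
move=> a k; have -> : (c *: g + g') a k = c * g a k + g' a k by [].
apply: (@le_trans _ _ ((norm c * norm (g a k) + norm (g' a k)) * Num.min r r' ^+ (edeg a + k))).
  rewrite ler_wpM2r ?exprn_ge0 // ?(ltW m0) //.
  by rewrite -Normc.normcM; exact: le_normcD.
rewrite !mulrDl lerD // -?mulrA.
  rewrite ler_wpM2l ?normc_ge0 //.
  by apply: expr_min (HM a k); rewrite ?normc_ge0 ?ge_min ?lexx.
by apply: expr_min (HM' a k); rewrite ?normc_ge0 ?ge_min ?lexx ?orbT.
Qed.

Lemma gevrey_mul h g : convergent h -> gevrey g -> gevrey (lmul h g).
Proof.
move=> /convergentP[r [M [r0 M0 HM]]] /gevreyP[g0 [r' [M' [r'0 M'0 HM']]]].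
apply/gevreyP; split=> [a j j0|].
  by rewrite /lmul /cmul big1 // => b _; rewrite g0 ?mulr0.
pose s := Num.min r r'; have s0 : 0 < s by rewrite lt_min r0.
have {}HM a : norm (h a) * s ^+ edeg a <= M.
  by apply: expr_min (HM a); rewrite ?normc_ge0 ?ge_min ?lexx.
have {}HM' a (k : nat) : norm (g a k) * s ^+ (edeg a + k) <= M' * k`!%:R.
  by apply: expr_min (HM' a k); rewrite ?normc_ge0 ?ge_min ?lexx ?orbT.
exists (s / 2), (M * M' * (2 ^+ #|Y| * 2)); split; first by rewrite divr_gt0.
  by rewrite !mulr_ge0 ?exprn_ge0.
move=> a k; have p0 l : 0 <= (s / 2) ^+ l by rewrite exprn_ge0 // divr_ge0 // ltW.
apply: (@le_trans _ _ (\sum_(b : bexp (edeg a) | ele (bval b) a)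
    M * M' * k`!%:R * 2^-1 ^+ edeg (bval b))).
  apply: (@le_trans _ _ ((\sum_(b : bexp (edeg a) | ele (bval b) a)
    norm (h (bval b) * g (esub a (bval b)) k)) * (s / 2) ^+ (edeg a + k))).
    by rewrite ler_wpM2r // normc_sum.
  rewrite mulr_suml; apply: ler_sum => b ba.
  have -> : (edeg a + k = edeg (bval b) + (edeg (esub a (bval b)) + k))%N.
    by rewrite addnA ele_edeg.
  rewrite Normc.normcM exprD [in X in _ * (X * _)]expr_half.
  have -> : norm (h (bval b)) * norm (g (esub a (bval b)) k) *
     (s ^+ edeg (bval b) * 2^-1 ^+ edeg (bval b) *
      (s / 2) ^+ (edeg (esub a (bval b)) + k)) =
     (norm (h (bval b)) * s ^+ edeg (bval b)) *
     (norm (g (esub a (bval b)) k) * (s / 2) ^+ (edeg (esub a (bval b)) + k)) *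
      2^-1 ^+ edeg (bval b) by ring.
  rewrite -[M * M' * _]mulrA ler_wpM2r ?exprn_ge0 // ler_pM //.
  - by rewrite mulr_ge0 ?normc_ge0 ?exprn_ge0 ?ltW.
  - by rewrite mulr_ge0 ?normc_ge0.
  apply: expr_min (HM' _ _); rewrite ?normc_ge0 ?divr_gt0 //.
  by rewrite ler_pdivrMr // mulr_natr mulr2n lerDl ltW.
rewrite -mulr_sumr -[leRHS]mulrA [_ * k`!%:R in leRHS]mulrC mulrA.
rewrite ler_wpM2l ?mulr_ge0 //.
have -> : \sum_(b : bexp (edeg a) | ele (bval b) a) (2^-1 : R) ^+ edeg (bval b)
   = \sum_(t <- [seq bval c | c <- enum {: bexp (edeg a)} & ele (bval c) a])
       2^-1 ^+ edeg t.
  by rewrite big_map big_filter big_enum_cond.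
apply: half_sum1; rewrite map_inj_uniq; last exact: bval_inj.
by apply: filter_uniq; exact: enum_uniq.
Qed.

Lemma gevrey_der y g : gevrey g -> gevrey (lder y g).
Proof.
move=> /gevreyP[g0 [r [M [r0 M0 HM]]]]; apply/gevreyP; split=> [a j j0|].
  by rewrite /lder /cder g0 ?mulr0.
exists (r / 2), (M / r); split; rewrite ?divr_gt0 ?divr_ge0 // ?ltW //.
move=> a k; rewrite /lder /cder Normc.normcM normc_nat expr_half.
have := HM (eadd a (eunit y)) k; rewrite edeg_eadd edeg_eunit addnAC addn1 exprSr.
rewrite mulrA -(ler_pdivlMr _ _ r0) => H.
set x := norm _ in H *.
apply: (@le_trans _ _ (x * r ^+ (edeg a + k))); last by rewrite mulrAC.
rewrite [leLHS](_ : _ = x * r ^+ (edeg a + k) *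
  ((a y).+1%:R * 2^-1 ^+ (edeg a + k))); last by ring.
rewrite -[leRHS]mulr1 ler_wpM2l ?nat_half ?(leq_trans (leq_edeg a y)) ?leq_addr //.
by rewrite mulr_ge0 ?normc_ge0 ?exprn_ge0 // ltW.
Qed.

Lemma gevrey_u g : gevrey g -> gevrey (ushift 1 g).
Proof.
move=> /gevreyP[g0 [r [M [r0 M0 HM]]]]; apply/gevreyP; split=> [a j j0|].
  by rewrite /ushift g0 // (lt_trans _ j0) // ltrBlDr ltrDl.
exists r, (M * r); split; rewrite ?mulr_ge0 // ?ltW //.
move=> a [|k].
  by rewrite /ushift g0 // Normc.normc0 mul0r !mulr_ge0 // ltW.
rewrite /ushift -[k.+1]addn1 PoszD addrK addnA exprD expr1 mulrA.
rewrite [leRHS]mulrAC ler_wpM2r ?(ltW r0) //; apply: le_trans (HM a k) _.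
by rewrite ler_wpM2l // addn1 ler_nat factS leq_pmull.
Qed.

Lemma gevrey_u2du g : gevrey g -> gevrey (u2du g).
Proof.
move=> /gevreyP[g0 [r [M [r0 M0 HM]]]]; apply/gevreyP; split=> [a j j0|].
  by rewrite /u2du g0 ?mulr0 // (lt_trans _ j0) // ltrBlDr ltrDl.
exists r, (M * r); split; rewrite ?mulr_ge0 // ?ltW //.
move=> a [|k].
  by rewrite /u2du g0 // mulr0 Normc.normc0 mul0r !mulr_ge0 // ltW.
rewrite /u2du -[k.+1]addn1 PoszD addrK addnA exprD expr1 mulrA.
rewrite [leRHS]mulrAC ler_wpM2r ?(ltW r0) // Normc.normcM normc_nat -mulrA.
apply: (@le_trans _ _ (k%:R * (M * k`!%:R))); first by rewrite ler_wpM2l.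
rewrite mulrCA ler_wpM2l // -natrM ler_nat addn1 factS leq_mul2r.
by rewrite leqnSn orbT.
Qed.

Lemma ushiftD (e e' : int) g : ushift e (ushift e' g) = ushift (e + e') g.
Proof. by apply/funext => a; apply/funext => j; rewrite /ushift opprD addrA. Qed.

Lemma ushift0 g : ushift 0 g = g.
Proof. by apply/funext => a; apply/funext => j; rewrite /ushift subr0. Qed.

Lemma gevrey_ushift (N : nat) g : gevrey g -> gevrey (ushift N%:Z g).
Proof.
elim: N => [|N IH] Hg; first by rewrite ushift0.
by rewrite -add1n PoszD -ushiftD; apply/gevrey_u/IH.
Qed.

Lemma laurent_gevrey g : gevrey g -> gevrey_laurent g.
Proof. by exists 0%N; rewrite ushift0. Qed.

Lemma laurentD (c : C) g g' :
  gevrey_laurent g -> gevrey_laurent g' -> gevrey_laurent (c *: g + g').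
Proof.
move=> [N Hg] [N' Hg']; exists (N + N')%N.
have -> : ushift (N + N')%N (c *: g + g') =
    c *: ushift (N + N')%N g + ushift (N + N')%N g' by [].
apply: gevreyD; last by rewrite PoszD -ushiftD; exact: gevrey_ushift.
by rewrite addnC PoszD -ushiftD; exact: gevrey_ushift.
Qed.

Lemma laurent_mul h g : convergent h -> gevrey_laurent g -> gevrey_laurent (lmul h g).
Proof. by move=> Hh [N Hg]; exists N; apply: gevrey_mul Hh Hg. Qed.

Lemma laurent_der y g : gevrey_laurent g -> gevrey_laurent (lder y g).
Proof. by move=> [N Hg]; exists N; apply: (@gevrey_der y) Hg. Qed.

Lemma laurent_u g : gevrey_laurent g -> gevrey_laurent (ushift 1 g).
Proof.
move=> [N Hg]; exists N; rewrite ushiftD addrC -ushiftD; exact: gevrey_u.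
Qed.

Lemma laurent_uinv g : gevrey_laurent g -> gevrey_laurent (ushift (-1) g).
Proof. by move=> [N Hg]; exists N.+1; rewrite ushiftD -addn1 PoszD addrK. Qed.

Lemma convergent_proj g : gevrey g -> convergent (cproj g).
Proof.
move=> /gevreyP[g0 [r [M [r0 M0 HM]]]]; apply/convergentP; exists r, M.
by split=> // a; have := HM a 0%N; rewrite addn0 fact0 mulr1.
Qed.

Lemma convergentE h g : gevrey g -> g = cincl h -> convergent h.
Proof. by move=> Hg gE; apply/cincl_gevrey; rewrite -gE. Qed.

Lemma convergent0 : convergent (0 : fps).
Proof. exact: convergent_proj gevrey0. Qed.

Lemma convergentD (c : C) h h' : convergent h -> convergent h' ->
  convergent (c *: h + h').
Proof.
move=> /cincl_gevrey Hh /cincl_gevrey Hh'.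
exact: convergent_proj (gevreyD c Hh Hh').
Qed.

Lemma convergent_mul h h' : convergent h -> convergent h' -> convergent (cmul h h').
Proof. by move=> Hh /cincl_gevrey Hh'; exact: convergent_proj (gevrey_mul Hh Hh'). Qed.

Lemma convergent_der y h : convergent h -> convergent (cder y h).
Proof. by move=> /cincl_gevrey Hh; exact: convergent_proj (gevrey_der y Hh). Qed.

Lemma convergent_mono e : convergent (cmono e : fps).
Proof.
apply/convergentP; exists 1, 1; split=> // a; rewrite expr1n mulr1 /cmono.
by case: eqP => _; rewrite ?Normc.normc0 ?Normc.normc1.
Qed.

End Closure.

Section Pullback.
Context {R : realType} {Y Z : finType} (e : mexp Z -> mexp Y).
Local Notation C := R[i].

Lemma gevrey_pull (g : mexp Y -> int -> C) : (forall a, edeg (e a) = edeg a) ->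
  gevrey g -> gevrey (fun a j => g (e a) j).
Proof.
move=> He /gevreyP[g0 [r [M [r0 M0 HM]]]]; apply/gevreyP; split=> [a j j0|].
  exact: g0.
by exists r, M; split=> // a k; rewrite -He.
Qed.

Lemma convergent_pull (P : pred (mexp Z)) (h : mexp Y -> C) :
    (forall a, P a -> edeg (e a) = edeg a) ->
  convergent h -> convergent (fun a => if P a then h (e a) else 0).
Proof.
move=> He /convergentP[r [M [r0 M0 HM]]]; apply/convergentP; exists r, M.
split=> // a; case: ifP => Pa; first by rewrite -He.
by rewrite Normc.normc0 mul0r.
Qed.

End Pullback.

Section Algebra.
Context {R : realType} {Y : finType}.
Local Notation C := R[i].
Implicit Types (h g : mexp Y -> C) (a b c : mexp Y).

Definition below a : seq (mexp Y) :=
  [seq b <- [seq bval d | d <- enum {: bexp (edeg a)}] | ele b a].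

Lemma below_uniq a : uniq (below a).
Proof.
rewrite filter_uniq // map_inj_uniq; last exact: bval_inj.
exact: enum_uniq.
Qed.

Lemma mem_below a b : (b \in below a) = ele b a.
Proof.
rewrite mem_filter; case ba: (ele b a) => //=; apply/mapP.
have ltb y : (b y < (edeg a).+1)%N.
  by rewrite ltnS (leq_trans _ (leq_edeg a y)) // (forallP ba).
exists [ffun y => Ordinal (ltb y)]; first by rewrite mem_enum.
by apply/ffunP => y; rewrite !ffunE.
Qed.

Lemma cmulE h g a : cmul h g a = \sum_(b <- below a) h b * g (esub a b).
Proof. by rewrite /below big_filter big_map big_enum_cond. Qed.

Lemma eleP b a : reflect (forall y, b y <= a y)%N (ele b a).
Proof. exact: forallP. Qed.

Lemma big_below (F : mexp Y -> C) a (P : pred (mexp Y)) (s : seq (mexp Y)) :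
  uniq s -> (forall b, (b \in s) = ele b a && P b) ->
  \sum_(b <- below a | P b) F b = \sum_(b <- s) F b.
Proof.
move=> us sE; rewrite -big_filter; apply: perm_big; apply: uniq_perm => //.
  exact/filter_uniq/below_uniq.
by move=> b; rewrite mem_filter mem_below sE andbC.
Qed.

Lemma cmulCA h h' g : cmul h (cmul h' g) = cmul h' (cmul h g).
Proof.
pose T h h' a := \sum_(b <- below a) \sum_(c <- below a | ele (eadd b c) a)
  h b * h' c * g (esub a (eadd b c)).
have TE k k' a : cmul k (cmul k' g) a = T k k' a.
  rewrite cmulE [LHS]big_seq [RHS]big_seq; apply: eq_bigr => b.
  rewrite mem_below => /eleP ba.
  have bcE c : ele c (esub a b) = ele c a && ele (eadd b c) a.
    apply/eleP/andP => [H|[_ /eleP H] y].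
      by split; apply/eleP => y; have := ba y; have := H y; rewrite !ffunE; lia.
    by have := ba y; have := H y; rewrite !ffunE; lia.
  rewrite (big_below _ (s := below (esub a b))) ?below_uniq //; last first.
    by move=> c; rewrite mem_below bcE.
  rewrite cmulE mulr_sumr; apply: eq_bigr => c _; rewrite mulrA; congr (_ * g _).
  by apply/ffunP => y; rewrite !ffunE; lia.
apply/funext => a; rewrite !TE /T.
rewrite [LHS](exchange_big_dep xpredT) //=; apply: eq_bigr => b _.
apply: eq_big => [c|c _]; first by congr (ele _ _); apply/ffunP => y; rewrite !ffunE addnC.
rewrite [h c * _]mulrC; congr (_ * g _).
by apply/ffunP => y; rewrite !ffunE addnC.
Qed.

Lemma cder_mul y h g : cder y (cmul h g) = cmul (cder y h) g + cmul h (cder y g).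
Proof.
apply/funext => a.
rewrite [RHS](_ : _ = cmul (cder y h) g a + cmul h (cder y g) a) //.
set e := eunit y; have eE z : e z = (z == y) by rewrite ffunE.
rewrite /(cder _ _) !cmulE mulr_sumr -/e.
pose G b := h b * g (esub (eadd a e) b).
have -> : \sum_(b <- below (eadd a e)) (a y).+1%:R * G b =
    \sum_(b <- below (eadd a e)) (b y)%:R * G b +
    \sum_(b <- below (eadd a e)) (esub (eadd a e) b y)%:R * G b.
  rewrite -big_split /= [LHS]big_seq [RHS]big_seq; apply: eq_bigr => b.
  rewrite mem_below => /eleP /(_ y); rewrite !ffunE eqxx => H.
  by rewrite -mulrDl -natrD subnKC // addn1.
congr (_ + _).
  rewrite (bigID (fun b => b y == 0%N)) /= big1 ?add0r; last first.
    by move=> b /eqP ->; rewrite mul0r.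
  rewrite (big_below _ (s := [seq eadd b e | b <- below a])).
  - rewrite big_map; apply: eq_bigr => b _; rewrite /cder /G ffunE eE eqxx addn1.
    rewrite mulrA; congr (_ * g _); apply/ffunP => z; rewrite !ffunE; lia.
  - rewrite map_inj_uniq ?below_uniq // => b c /ffunP bc; apply/ffunP => z.
    by have := bc z; rewrite !ffunE => /addIn.
  - move=> b; apply/mapP/andP => [[c]|[/eleP H by0]].
      rewrite mem_below => /eleP H ->; split; last by rewrite ffunE eE eqxx addn1.
      by apply/eleP => z; rewrite !ffunE leq_add2r.
    exists (esub b e).
      rewrite mem_below; apply/eleP => z; have := H z; rewrite !ffunE.
      by case: eqP => [->|_]; lia.
    apply/ffunP => z; rewrite !ffunE; case: eqP => [->|_]; last by rewrite subn0 addn0.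
    by rewrite addn1 subn1 prednK // lt0n.
rewrite (bigID (fun b => ele b a)) /= [X in _ + X]big_seq_cond.
rewrite [X in _ + X]big1 ?addr0; last first.
  move=> b; rewrite mem_below => /andP[/eleP H nba].
  rewrite [esub _ _ y](_ : _ = 0%N) ?mul0r //; apply/eqP; rewrite ffunE subn_eq0.
  rewrite leqNgt; apply: contra nba => Hy; apply/eleP => z; have := H z.
  move: Hy; rewrite !ffunE eqxx; case: eqP => [->|_]; lia.
rewrite (big_below _ (s := below a)) ?below_uniq //; last first.
  move=> b; rewrite mem_below; case ba: (ele b a); rewrite ?andbF // andbT.
  by apply/esym/eleP => z; move/eleP: ba => /(_ z); rewrite ffunE; lia.
rewrite [LHS]big_seq [RHS]big_seq; apply: eq_bigr => b.
rewrite mem_below => /eleP ba; rewrite /cder /G mulrCA.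
have -> : esub (eadd a e) b = eadd (esub a b) e.
  by apply/ffunP => z; have := ba z; rewrite !ffunE; lia.
by rewrite [eadd _ _ y]ffunE eE eqxx addn1.
Qed.

Lemma cder_comm y z h : cder y (cder z h) = cder z (cder y h).
Proof.
apply/funext => a; rewrite /cder !ffunE mulrCA.
have -> : eadd (eadd a (eunit y)) (eunit z) = eadd (eadd a (eunit z)) (eunit y).
  by apply/ffunP => w; rewrite !ffunE addnAC.
case: (eqVneq y z) => [->|yz]; first by rewrite mulrCA.
by rewrite ?(negPf yz) !addn0.
Qed.

End Algebra.

Section Carriers.
Variables (R : realType) (Y : finType).
Local Notation C := R[i].

Definition cps_pred : {pred mexp Y -> C} := fun h => `[< convergent h >].
Definition gps_pred : {pred mexp Y -> int -> C} := fun g => `[< gevrey g >].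
Definition lps_pred : {pred mexp Y -> int -> C} := fun g => `[< gevrey_laurent g >].

Lemma cps_closed : submod_closed cps_pred.
Proof.
split; first exact/asboolP/convergent0.
by move=> c h h' /asboolP Hh /asboolP Hh'; apply/asboolP/convergentD.
Qed.

Lemma gps_closed : submod_closed gps_pred.
Proof.
split; first exact/asboolP/gevrey0.
by move=> c h h' /asboolP Hh /asboolP Hh'; apply/asboolP/gevreyD.
Qed.

Lemma lps_closed : submod_closed lps_pred.
Proof.
split; first exact/asboolP/laurent_gevrey/gevrey0.
by move=> c h h' /asboolP Hh /asboolP Hh'; apply/asboolP/laurentD.
Qed.

HB.instance Definition _ := GRing.isSubmodClosed.Build C _ cps_pred cps_closed.
HB.instance Definition _ := GRing.isSubmodClosed.Build C _ gps_pred gps_closed.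
HB.instance Definition _ := GRing.isSubmodClosed.Build C _ lps_pred lps_closed.

(* C{y}, C{y}{{u}} and C{y}{{u}}[u^-1] *)
Record cps := Cps { cps_val :> mexp Y -> C; _ : cps_val \in cps_pred }.
Record gps := Gps { gps_val :> mexp Y -> int -> C; _ : gps_val \in gps_pred }.
Record lps := Lps { lps_val :> mexp Y -> int -> C; _ : lps_val \in lps_pred }.

HB.instance Definition _ := [isSub for cps_val].
HB.instance Definition _ := [Choice of cps by <:].
HB.instance Definition _ := [SubChoice_isSubLmodule of cps by <:].
HB.instance Definition _ := [isSub for gps_val].
HB.instance Definition _ := [Choice of gps by <:].
HB.instance Definition _ := [SubChoice_isSubLmodule of gps by <:].
HB.instance Definition _ := [isSub for lps_val].
HB.instance Definition _ := [Choice of lps by <:].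
HB.instance Definition _ := [SubChoice_isSubLmodule of lps by <:].

End Carriers.


Section Operations.
Context {R : realType} {Y : finType}.
Local Notation cps := (cps R Y).
Local Notation gps := (gps R Y).
Local Notation lps := (lps R Y).

Lemma cpsP (h : cps) : convergent h.
Proof. by case: h => h /= /asboolP. Qed.
Lemma gpsP (g : gps) : gevrey g.
Proof. by case: g => g /= /asboolP. Qed.
Lemma lpsP (g : lps) : gevrey_laurent g.
Proof. by case: g => g /= /asboolP. Qed.

Definition cps_mk (h : mexp Y -> R[i]) (hP : convergent h) : cps := Cps (asboolT hP).
Definition gps_mk (g : mexp Y -> int -> R[i]) (gP : gevrey g) : gps := Gps (asboolT gP).
Definition lps_mk (g : mexp Y -> int -> R[i]) (gP : gevrey_laurent g) : lps :=
  Lps (asboolT gP).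

Definition cps_mono (e : mexp Y) : cps := cps_mk (convergent_mono e).
Definition cps_mul (h h' : cps) : cps := cps_mk (convergent_mul (cpsP h) (cpsP h')).
Definition cps_der (y : Y) (h : cps) : cps := cps_mk (convergent_der y (cpsP h)).

Definition gps_incl (h : cps) : gps := gps_mk ((cincl_gevrey h).2 (cpsP h)).
Definition gps_proj (g : gps) : cps := cps_mk (convergent_proj (gpsP g)).
Definition gps_mul (h : cps) (g : gps) : gps := gps_mk (gevrey_mul (cpsP h) (gpsP g)).
Definition gps_der (y : Y) (g : gps) : gps := gps_mk (gevrey_der y (gpsP g)).
Definition gps_u (g : gps) : gps := gps_mk (gevrey_u (gpsP g)).
Definition gps_u2du (g : gps) : gps := gps_mk (gevrey_u2du (gpsP g)).

Definition lps_incl (g : gps) : lps := lps_mk (laurent_gevrey (gpsP g)).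
Definition lps_mul (h : cps) (g : lps) : lps := lps_mk (laurent_mul (cpsP h) (lpsP g)).
Definition lps_der (y : Y) (g : lps) : lps := lps_mk (laurent_der y (lpsP g)).
Definition lps_u (g : lps) : lps := lps_mk (laurent_u (lpsP g)).
Definition lps_uinv (g : lps) : lps := lps_mk (laurent_uinv (lpsP g)).

End Operations.
Arguments cps_mono R {Y} e.

Section Coordinates.
Variables (n : nat) (P : finType).

(* variables x_0, ..., x_n and parameters s_p, p in P *)
Definition vars : finType := ('I_n.+1 + P)%type.

(* the exponent of x^a s^b *)
Definition xs (a : mexp 'I_n.+1) (b : mexp P) : mexp vars :=
  [ffun v => match v with inl i => a i | inr p => b p end].
Definition xpart (e : mexp vars) : mexp 'I_n.+1 := [ffun i => e (inl i)].
Definition spart (e : mexp vars) : mexp P := [ffun p => e (inr p)].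

Lemma edeg_xs a b : edeg (xs a b) = (edeg a + edeg b)%N.
Proof.
rewrite /edeg big_sumType /=; congr addn;
  by apply: eq_bigr => i _; rewrite ffunE.
Qed.

Lemma edeg_parts (e : mexp vars) : edeg e = (edeg (xpart e) + edeg (spart e))%N.
Proof.
rewrite /edeg big_sumType /=; congr addn;
  by apply: eq_bigr => i _; rewrite ffunE.
Qed.

Lemma edeg_spart (e : mexp vars) : xpart e == ezero -> edeg (spart e) = edeg e.
Proof.
by rewrite edeg_parts => /eqP ->; rewrite /edeg [X in (X + _)%N]big1 // => i _;
  rewrite ffunE.
Qed.

End Coordinates.

Lemma edeg_restr (n : nat) (P : finType) (e : mexp (vars n void)) :
  edeg (xs (xpart e) (ezero : mexp P)) = edeg e.
Proof.
rewrite edeg_xs edeg_parts; congr addn; rewrite /edeg big1 => [|p _].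
  by rewrite big1 // => -[].
by rewrite ffunE.
Qed.

Section CoordinateMaps.
Context {R : realType} {n : nat} {P : finType}.

(* C{s} as a subring of C{x, s} *)
Definition sincl (h : cps R P) : cps R (vars n P) :=
  cps_mk (convergent_pull (P := fun e => xpart e == ezero) (@edeg_spart n P) (cpsP h)).

(* restriction to s = 0 *)
Definition cps_restr (h : cps R (vars n P)) : cps R (vars n void) :=
  cps_mk (convergent_pull (P := predT) (fun e _ => edeg_restr P e) (cpsP h)).
Definition gps_restr (g : gps R (vars n P)) : gps R (vars n void) :=
  gps_mk (gevrey_pull (@edeg_restr n P) (gpsP g)).

End CoordinateMaps.

Section QuotientMaps.
Variables (V W : zmodType).

(* The map induced by [phi] on quotients, for [phi] carrying [A] into [B]. *)
Definition qmap (A : zmodClosed V) (B : zmodClosed W) (phi : V -> W)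
    (w : Quotient.quot A) : Quotient.quot B :=
  \pi_(Quotient.quot B) (phi (repr w)).
#[local] Arguments qmap A B phi w : clear implicits.

Lemma qmapE (A : zmodClosed V) (B : zmodClosed W) (phi : V -> W) :
    zmod_morphism phi -> (forall v, v \in A -> phi v \in B) ->
  forall v, qmap A B phi (\pi_(Quotient.quot A) v) = \pi_(Quotient.quot B) (phi v).
Proof.
move=> phiB AB v; apply/eqP; rewrite -Quotient.idealrBE -phiB; apply: AB.
by rewrite Quotient.idealrBE reprK.
Qed.

Definition im_pred (phi : V -> W) : {pred W} := fun w => `[< exists v, w = phi v >].

Lemma im_closed (phi : V -> W) : zmod_morphism phi -> zmod_closed (im_pred phi).
Proof.
move=> phiB; split=> [|_ _ /asboolP[v ->] /asboolP[v' ->]]; apply/asboolP.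
  by exists 0; have := phiB 0 0; rewrite !subrr.
by exists (v - v'); rewrite phiB.
Qed.

End QuotientMaps.
Arguments qmap {V W} A B phi w.

Section Linearity.
Context {R : realType} {Y : finType}.

Lemma cmulB (h : mexp Y -> R[i]) : zmod_morphism (cmul h).
Proof.
move=> g g'; apply/funext => a.
rewrite [RHS](_ : _ = cmul h g a - cmul h g' a) // /cmul -sumrB.
by apply: eq_bigr => b _; rewrite -mulrBr.
Qed.

Lemma cderB y : zmod_morphism (@cder R Y y).
Proof. by move=> g g'; apply/funext => a; rewrite /cder mulrBr. Qed.

End Linearity.

Section OperationsLinear.
Context {R : realType} {Y : finType}.

Lemma lmulB (h : mexp Y -> R[i]) : zmod_morphism (lmul h).
Proof.
move=> g g'; apply/funext => a; apply/funext => j.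
by have /(congr1 (fun k => k a)) := cmulB h (g^~ j) (g'^~ j).
Qed.

Lemma lderB y : zmod_morphism (@lder R Y y).
Proof.
move=> g g'; apply/funext => a; apply/funext => j.
by have /(congr1 (fun k => k a)) := cderB y (g^~ j) (g'^~ j).
Qed.

Lemma u2duB : zmod_morphism (@u2du R Y).
Proof. by move=> g g'; apply/funext => a; apply/funext => j; rewrite /u2du mulrBr. Qed.

Lemma cps_mulB (h : cps R Y) : zmod_morphism (cps_mul h).
Proof. by move=> g g'; apply/val_inj/cmulB. Qed.
Lemma cps_derB y : zmod_morphism (@cps_der R Y y).
Proof. by move=> g g'; apply/val_inj/cderB. Qed.
Lemma gps_mulB (h : cps R Y) : zmod_morphism (gps_mul h).
Proof. by move=> g g'; apply/val_inj/lmulB. Qed.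
Lemma gps_derB y : zmod_morphism (@gps_der R Y y).
Proof. by move=> g g'; apply/val_inj/lderB. Qed.
Lemma gps_uB : zmod_morphism (@gps_u R Y).
Proof. by move=> g g'; apply/val_inj. Qed.
Lemma gps_u2duB : zmod_morphism (@gps_u2du R Y).
Proof. by move=> g g'; apply/val_inj/u2duB. Qed.
Lemma gps_projB : zmod_morphism (@gps_proj R Y).
Proof. by move=> g g'; apply/val_inj. Qed.
Lemma lps_mulB (h : cps R Y) : zmod_morphism (lps_mul h).
Proof. by move=> g g'; apply/val_inj/lmulB. Qed.
Lemma lps_derB y : zmod_morphism (@lps_der R Y y).
Proof. by move=> g g'; apply/val_inj/lderB. Qed.
Lemma lps_uB : zmod_morphism (@lps_u R Y).
Proof. by move=> g g'; apply/val_inj. Qed.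
Lemma lps_uinvB : zmod_morphism (@lps_uinv R Y).
Proof. by move=> g g'; apply/val_inj. Qed.
Lemma lps_inclB : zmod_morphism (@lps_incl R Y).
Proof. by move=> g g'; apply/val_inj. Qed.

End OperationsLinear.

Section RestrLinear.
Context {R : realType} {n : nat} {P : finType}.

Lemma cps_restrB : zmod_morphism (@cps_restr R n P).
Proof. by move=> g g'; apply/val_inj. Qed.
Lemma gps_restrB : zmod_morphism (@gps_restr R n P).
Proof. by move=> g g'; apply/val_inj. Qed.

End RestrLinear.

(* A relative (n+1)-form [g dx_0 ^ ... ^ dx_n] is represented by its
   coefficient [g], and a relative n-form
   [\sum_i (-1)^i eta_i dx_0 ^ .. ^ (omit dx_i) ^ .. ^ dx_n] by the family
   [eta].  In these coordinates [ud - dF^] and [dF^] from n-forms to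
   (n+1)-forms are [gps_tw] (or [lps_tw]) and [cps_wedge] below; as there are no
   relative (n+2)-forms, the (n+1)st cohomology groups are their cokernels. *)

Section GaussManin.
Context {R : realType} {n : nat} {P : finType}.
Local Notation Y := (vars n P).
Variable F : cps R Y.

Definition gps_tw (eta : 'I_n.+1 -> gps R Y) : gps R Y :=
  \sum_i (gps_u (gps_der (inl i) (eta i)) - gps_mul (cps_der (inl i) F) (eta i)).
Definition lps_tw (eta : 'I_n.+1 -> lps R Y) : lps R Y :=
  \sum_i (lps_u (lps_der (inl i) (eta i)) - lps_mul (cps_der (inl i) F) (eta i)).
Definition cps_wedge (eta : 'I_n.+1 -> cps R Y) : cps R Y :=
  \sum_i cps_mul (cps_der (inl i) F) (eta i).


Lemma gps_twB : zmod_morphism gps_tw.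
Proof.
move=> x y; rewrite /gps_tw -sumrB; apply: eq_bigr => i _.
rewrite [(x - y) i](_ : _ = x i - y i) // gps_derB gps_uB gps_mulB.
by rewrite !opprD opprK addrACA.
Qed.

Lemma lps_twB : zmod_morphism lps_tw.
Proof.
move=> x y; rewrite /lps_tw -sumrB; apply: eq_bigr => i _.
rewrite [(x - y) i](_ : _ = x i - y i) // lps_derB lps_uB lps_mulB.
by rewrite !opprD opprK addrACA.
Qed.

Lemma cps_wedgeB : zmod_morphism cps_wedge.
Proof.
move=> x y; rewrite /cps_wedge -sumrB; apply: eq_bigr => i _.
by rewrite [(x - y) i](_ : _ = x i - y i) // cps_mulB.
Qed.

Definition gps_exact := im_pred gps_tw.
Definition lps_exact := im_pred lps_tw.
Definition cps_exact := im_pred cps_wedge.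

HB.instance Definition _ :=
  GRing.isZmodClosed.Build (gps R Y) gps_exact (im_closed gps_twB).
HB.instance Definition _ :=
  GRing.isZmodClosed.Build (lps R Y) lps_exact (im_closed lps_twB).
HB.instance Definition _ :=
  GRing.isZmodClosed.Build (cps R Y) cps_exact (im_closed cps_wedgeB).

(* H''_F, G_F and Omega_F *)
Definition brieskorn := Quotient.quot gps_exact.
Definition gauss_manin := Quotient.quot lps_exact.
Definition jacobian := Quotient.quot cps_exact.

HB.instance Definition _ := GRing.Zmodule.on brieskorn.
HB.instance Definition _ := GRing.Zmodule.on gauss_manin.
HB.instance Definition _ := GRing.Zmodule.on jacobian.

End GaussManin.

Section Actions.
Context {R : realType} {n : nat} {P : finType}.
Local Notation Y := (vars n P).
Variable F : cps R Y.
Local Notation H := (brieskorn F).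
Local Notation G := (gauss_manin F).
Local Notation Om := (jacobian F).

Definition H_class (h : cps R Y) : H := \pi_(Quotient.quot (gps_exact F)) (gps_incl h).
Definition Om_class (h : cps R Y) : Om := \pi_(Quotient.quot (cps_exact F)) h.

Definition H_scale (c : R[i]) : H -> H := qmap (gps_exact F) (gps_exact F) ( *:%R c).
Definition Om_scale (c : R[i]) : Om -> Om := qmap (cps_exact F) (cps_exact F) ( *:%R c).

(* multiplication by elements of C{s} *)
Definition H_smul (h : cps R P) : H -> H :=
  qmap (gps_exact F) (gps_exact F) (gps_mul (sincl h)).
Definition Om_smul (h : cps R P) : Om -> Om :=
  qmap (cps_exact F) (cps_exact F) (cps_mul (sincl h)).

Definition H_u : H -> H := qmap (gps_exact F) (gps_exact F) (@gps_u R Y).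
Definition H_upow (e : nat) : H -> H := iter e H_u.
Definition H_t : H -> H :=
  qmap (gps_exact F) (gps_exact F) (fun g => gps_mul F g + gps_u2du g).

Definition G_uinv : G -> G := qmap (lps_exact F) (lps_exact F) (@lps_uinv R Y).
Definition G_ds (p : P) : G -> G :=
  qmap (lps_exact F) (lps_exact F)
    (fun g => lps_der (inr p) g - lps_uinv (lps_mul (cps_der (inr p) F) g)).

(* H''_F -> Omega_F and H''_F -> G_F *)
Definition H_proj : H -> Om := qmap (gps_exact F) (cps_exact F) (@gps_proj R Y).
Definition H_incl : H -> G := qmap (gps_exact F) (lps_exact F) (@lps_incl R Y).

(* the submodule m_0^j H''_F *)
Fixpoint H_mpow (j : nat) : set H :=
  if j is j'.+1 then
    [set w | exists (N : nat) (h : 'I_N -> cps R P) (v : 'I_N -> H),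
       [/\ forall i, h i ezero = 0, forall i, H_mpow j' (v i)
         & w = \sum_i H_smul (h i) (v i)]]%classic
  else setT.

End Actions.

Section Restriction.
Context {R : realType} {n : nat} {P : finType}.

(* the maps induced by restriction to s = 0 when [f] is [F] restricted to s = 0 *)
Definition H_restr (F : cps R (vars n P)) (f : cps R (vars n void)) :
    brieskorn F -> brieskorn f :=
  qmap (gps_exact F) (gps_exact f) (@gps_restr R n P).
Definition Om_restr (F : cps R (vars n P)) (f : cps R (vars n void)) :
    jacobian F -> jacobian f :=
  qmap (cps_exact F) (cps_exact f) (@cps_restr R n P).

End Restriction.

Section BrieskornPham.
Context {n : nat}.
Variable m : 'I_n.+1 -> nat.

(* the exponents nu with 0 <= nu_i <= m_i - 2 *)
Definition Gam : finType := {dffun forall i : 'I_n.+1, 'I_(m i).-1}.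
Definition gexp (nu : Gam) : mexp 'I_n.+1 := [ffun i => nu i : nat].

(* p(a)_i, q(a)_i, r(a), e_a, A'_k and q(a, b)_i *)
Definition pa (a : mexp Gam) (i : 'I_n.+1) : nat := (\sum_(nu : Gam) nu i * a nu)%N.
Definition qa (a : mexp Gam) (i : 'I_n.+1) : nat := (pa a i %/ m i)%N.
Definition ra (a : mexp Gam) : mexp 'I_n.+1 := [ffun i => pa a i %% m i]%N.
Definition ea (a : mexp Gam) : int := (\sum_i qa a i)%N%:Z - (edeg a)%:Z.

Definition in_Gam (e : mexp 'I_n.+1) : bool := [forall i, e i <= m i - 2]%N.
Definition in_A' (k : nat) (a : mexp Gam) : bool :=
  [&& (edeg a <= k)%N, 0 <= ea a & in_Gam (ra a)].

Definition qab (a b : mexp Gam) (i : 'I_n.+1) : nat :=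
  ((ra b i + pa (esub a b) i) %/ m i)%N.

Section Series.
Variable R : realType.
Local Notation C := R[i].

Definition pham (P : finType) : cps R (vars n P) :=
  \sum_i cps_mono R (xs [ffun j => if j == i then m i else 0%N] ezero).
Definition pham_f : cps R (vars n void) := pham void.
Definition pham_F : cps R (vars n Gam) :=
  pham Gam + \sum_(nu : Gam) cps_mono R (xs (gexp nu) (eunit nu)).

Local Notation f := pham_f.
Local Notation F := pham_F.

(* The canonical good section: the C-linear section of H''_f -> Omega_f with
   image I_0. *)
Definition canonical_section (sigma0 : jacobian f -> brieskorn f) : Prop :=
  [/\ forall (c : C) w w', sigma0 (Om_scale c w + w') = H_scale c (sigma0 w) + sigma0 w',
      forall w, H_proj (sigma0 w) = w
    & range sigma0 =
      [set v | exists c : Gam -> C,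
         v = \sum_(nu : Gam) H_scale (c nu) (H_class f (cps_mono R (xs (gexp nu) ezero)))]%classic].

(* Its extension to a C{s}-linear section, with image I_S. *)
Definition good_extension (sigma0 : jacobian f -> brieskorn f)
    (sigmaS : jacobian F -> brieskorn F) : Prop :=
  [/\ forall (h : cps R Gam) w w',
        sigmaS (Om_smul h w + w') = H_smul h (sigmaS w) + sigmaS w',
      forall w, H_proj (sigmaS w) = w,
      forall w, H_restr f (sigmaS w) = sigma0 (Om_restr f w),
      (* t I_S is contained in I_S + u I_S *)
      forall v, range sigmaS v -> exists v1 v2,
        [/\ range sigmaS v1, range sigmaS v2 & H_t v = v1 + H_u v2]
    & (* d/ds_nu I_S is contained in I_S + u^-1 I_S *)
      forall nu v, range sigmaS v -> exists v1 v2,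
        [/\ range sigmaS v1, range sigmaS v2
          & G_ds nu (H_incl v) = H_incl v1 + G_uinv (H_incl v2)]].

(* The lift sigma_S^nabla; note that d/dt acts on G_F as u^-1. *)
Definition horizontal_lift (sigma0 : jacobian f -> brieskorn f)
    (sigmaS : jacobian F -> brieskorn F) (sigmaN : jacobian f -> brieskorn F) : Prop :=
  [/\ forall (c : C) w w', sigmaN (Om_scale c w + w') = H_scale c (sigmaN w) + sigmaN w',
      forall w, H_restr f (sigmaN w) = sigma0 w,
      forall w, range sigmaS (sigmaN w)
    & forall nu w, exists2 v, range sigmaS v &
        G_ds nu (H_incl (sigmaN w)) = G_uinv (H_incl v)].

(* [Om_class f 1] is the class of dx_0 ^ ... ^ dx_n. *)
Definition primitive_form (zeta : brieskorn F) : Prop :=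
  exists sigma0 sigmaS sigmaN,
    [/\ canonical_section sigma0, good_extension sigma0 sigmaS,
        horizontal_lift sigma0 sigmaS sigmaN
      & zeta = sigmaN (Om_class f (cps_mono R ezero))].

Definition coef_rec (k : nat) (c : mexp Gam -> C) : Prop :=
  c ezero = 1 /\
  forall a, in_A' k a -> a != ezero ->
    c a = - \sum_(b : bexp k | in_A' k (bval b) && elt (bval b) a)
      ((-1) ^+ edeg (esub a (bval b)) * (c (bval b) / (efact (esub a (bval b)))%:R) *
       \prod_i \prod_(1 <= l < (qab a (bval b) i).+1)
         (((ra (bval b) i + pa (esub a (bval b)) i)%N%:R - (l * m i)%N%:R + 1) / (m i)%:R)).

End Series.
End BrieskornPham.

(* The lemmas below whose names end in [E] show that the maps on quotients defined
   through [qmap] do not depend on the choice of representatives. *)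

Section FormalTwist.
Context {R : realType} {n : nat} {P : finType}.
Local Notation Y := (vars n P).
Local Notation fl := (mexp Y -> int -> R[i]).
Implicit Types (h F : mexp Y -> R[i]) (g : fl).

Definition ftw F (eta : 'I_n.+1 -> fl) : fl :=
  \sum_i (ushift 1 (lder (inl i) (eta i)) - lmul (cder (inl i) F) (eta i)).

Lemma lmulCA h h' g : lmul h (lmul h' g) = lmul h' (lmul h g).
Proof.
apply/funext => a; apply/funext => j.
exact: (congr1 (fun k => k a) (cmulCA h h' (g^~ j))).
Qed.

Lemma lder_mul y h g : lder y (lmul h g) = lmul (cder y h) g + lmul h (lder y g).
Proof.
apply/funext => a; apply/funext => j.
exact: (congr1 (fun k => k a) (cder_mul y h (g^~ j))).
Qed.

Lemma lder_comm y z g : lder y (lder z g) = lder z (lder y g).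
Proof.
apply/funext => a; apply/funext => j.
exact: (congr1 (fun k => k a) (cder_comm y z (g^~ j))).
Qed.

Lemma u2du_mul h g : u2du (lmul h g) = lmul h (u2du g).
Proof.
apply/funext => a; apply/funext => j; rewrite /u2du /lmul /cmul mulr_sumr.
by apply: eq_bigr => b _; rewrite mulrCA.
Qed.

Lemma u2du_der y g : u2du (lder y g) = lder y (u2du g).
Proof. by apply/funext => a; apply/funext => j; rewrite /u2du /lder /cder mulrCA. Qed.

Lemma u2du_u g : u2du (ushift 1 g) = ushift 1 (u2du g) + ushift 1 (ushift 1 g).
Proof.
apply/funext => a; apply/funext => j.
rewrite [RHS](_ : _ = (j - 1 - 1)%:~R * g a (j - 1 - 1) + g a (j - 1 - 1)) //.
by rewrite /u2du /ushift !rmorphB /=; ring.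
Qed.

Lemma ushift_mul e h g : ushift e (lmul h g) = lmul h (ushift e g).
Proof. by []. Qed.

Lemma ushift_der e y g : ushift e (lder y g) = lder y (ushift e g).
Proof. by []. Qed.

Lemma ushift1B e : zmod_morphism (@ushift R Y e).
Proof. by []. Qed.

Lemma morphD (V W : zmodType) (phi : V -> W) : zmod_morphism phi ->
  {morph phi : x y / x + y}.
Proof.
move=> phiB x y; have phi0 : phi 0 = 0 by have := phiB 0 0; rewrite !subrr.
by rewrite -[y in LHS]opprK phiB -[- y]add0r phiB phi0 sub0r opprK.
Qed.

Lemma morph_sum (V W : zmodType) (phi : V -> W) (I : Type) (s : seq I) (G : I -> V) :
  zmod_morphism phi -> phi (\sum_(i <- s) G i) = \sum_(i <- s) phi (G i).
Proof.
move=> phiB; apply: (big_morph phi (morphD phiB)).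
by have := phiB 0 0; rewrite !subrr.
Qed.

Lemma flD (p q : fl) a j : (p + q) a j = p a j + q a j.
Proof. by []. Qed.

Lemma flN (p : fl) a j : (- p) a j = - p a j.
Proof. by []. Qed.

Lemma ftw_mul F h eta : (forall i, cder (inl i) h = 0) ->
  lmul h (ftw F eta) = ftw F (fun i => lmul h (eta i)).
Proof.
move=> h0; rewrite /ftw (morph_sum _ _ (@lmulB _ _ h)); apply: eq_bigr => i _.
rewrite lmulB lmulCA lder_mul h0; congr (_ - _).
have -> : lmul 0 (eta i) = 0.
  apply/funext => a; apply/funext => j; rewrite /lmul /cmul big1 // => b _.
  by rewrite mul0r.
by rewrite add0r.
Qed.

Lemma ftw_u e F eta : ushift e (ftw F eta) = ftw F (fun i => ushift e (eta i)).
Proof.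
rewrite /ftw (morph_sum _ _ (@ushift1B e)); apply: eq_bigr => i _.
rewrite ushift1B; congr (_ - _).
by rewrite -ushift_der !ushiftD [e + 1]addrC.
Qed.

Lemma ftw_t F eta : lmul F (ftw F eta) + u2du (ftw F eta) =
  ftw F (fun i => lmul F (eta i) + u2du (eta i) + ushift 1 (eta i)).
Proof.
rewrite /ftw (morph_sum _ _ (@lmulB _ _ F)) (morph_sum _ _ (@u2duB _ _)) -big_split.
apply: eq_bigr => i _ /=; rewrite lmulB u2duB !(morphD (@lderB _ _ _)) !(morphD (@lmulB _ _ _)).
rewrite !(morphD (@ushift1B _)) lder_mul u2du_u u2du_der u2du_mul.
rewrite !(morphD (@ushift1B _)) -!ushift_mul -!ushift_der.
rewrite [lmul F (lmul _ _)]lmulCA !opprD.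
apply/funext => a; apply/funext => j; rewrite !(flD, flN).
ring.
Qed.

Lemma ftw_ds p F eta :
  lder (inr p) (ftw F eta) - ushift (-1) (lmul (cder (inr p) F) (ftw F eta)) =
  ftw F (fun i => lder (inr p) (eta i) - ushift (-1) (lmul (cder (inr p) F) (eta i))).
Proof.
rewrite /ftw (morph_sum _ _ (@lmulB _ _ _)) (morph_sum _ _ (@lderB _ _ _)).
rewrite (morph_sum _ _ (@ushift1B _)) -sumrB; apply: eq_bigr => i _.
have uV g : ushift 1 (ushift (-1) g) = g by rewrite ushiftD subrr ushift0.
have Vu g : ushift (-1) (ushift 1 g) = g by rewrite ushiftD addrC subrr ushift0.
set h := cder (inr p) F; set x : Y := inl i; set s : Y := inr p.
rewrite !lderB !lmulB !ushift1B lder_mul.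
rewrite -[lder x (ushift _ _)]/(ushift (-1) (lder x (lmul h (eta i)))) lder_mul uV.
rewrite -[lmul h (ushift _ _)]/(ushift 1 (lmul h (lder x (eta i)))) Vu.
rewrite -[lder s (ushift _ _)]/(ushift 1 (lder s (lder x (eta i)))) (lder_comm s).
rewrite -[lmul (cder x F) (ushift _ _)]/(ushift (-1) (lmul (cder x F) (lmul h (eta i)))).
rewrite (lmulCA h) (cder_comm s); apply/funext => a; apply/funext => j.
rewrite !(flD, flN); ring.
Qed.

End FormalTwist.

Section WellDefined.
Context {R : realType} {n : nat} {P : finType}.
Local Notation Y := (vars n P).
Variable F : cps R Y.

Lemma val_gps_tw (eta : 'I_n.+1 -> gps R Y) :
  gps_tw F eta = ftw F (fun i => eta i) :> (mexp Y -> int -> R[i]).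
Proof. exact: (morph_sum (phi := @gps_val R Y)). Qed.

Lemma val_lps_tw (eta : 'I_n.+1 -> lps R Y) :
  lps_tw F eta = ftw F (fun i => eta i) :> (mexp Y -> int -> R[i]).
Proof. exact: (morph_sum (phi := @lps_val R Y)). Qed.

Lemma cder_sincl i (h : cps R P) : cder (inl i : Y) (sincl h) = 0.
Proof.
apply/funext => e; rewrite /cder /=; case: eqP => [|_]; last by rewrite mulr0.
by move=> /ffunP/(_ i); rewrite !ffunE eqxx addn1.
Qed.

Lemma scale_gps_tw (c : R[i]) eta : c *: gps_tw F eta = gps_tw F (fun i => c *: eta i).
Proof.
rewrite /gps_tw scaler_sumr; apply: eq_bigr => i _.
rewrite scalerBr; congr (_ - _); apply/val_inj/funext => a; apply/funext => j.
  exact: mulrCA.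
rewrite [LHS](_ : _ = c * cmul (cder (inl i) F) (gps_val (eta i) ^~ j) a) //.
rewrite [RHS](_ : _ = cmul (cder (inl i) F) ((c *: gps_val (eta i)) ^~ j) a) //.
by rewrite /cmul mulr_sumr; apply: eq_bigr => b _; rewrite mulrCA.
Qed.

Lemma scale_cps_wedge (c : R[i]) eta :
  c *: cps_wedge F eta = cps_wedge F (fun i => c *: eta i).
Proof.
rewrite /cps_wedge scaler_sumr; apply: eq_bigr => i _; apply/val_inj/funext => a.
rewrite [LHS](_ : _ = c * cmul (cder (inl i) F) (eta i) a) //.
rewrite [RHS](_ : _ = cmul (cder (inl i) F) (c *: cps_val (eta i)) a) //.
by rewrite /cmul mulr_sumr; apply: eq_bigr => b _; rewrite mulrCA.
Qed.

Local Notation piH := (\pi_(brieskorn F)).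
Local Notation piG := (\pi_(gauss_manin F)).
Local Notation piO := (\pi_(jacobian F)).

Lemma scalerB_morph (V : lmodType R[i]) (c : R[i]) : zmod_morphism ( *:%R c : V -> V).
Proof. by move=> x y; rewrite scalerBr. Qed.

Lemma H_scaleE c g : H_scale c (piH g) = piH (c *: g).
Proof.
apply: qmapE; first exact: scalerB_morph.
move=> _ /asboolP[eta ->]; apply/asboolP; eexists; exact: scale_gps_tw.
Qed.

Lemma Om_scaleE c g : Om_scale c (piO g) = piO (c *: g).
Proof.
apply: qmapE; first exact: scalerB_morph.
move=> _ /asboolP[eta ->]; apply/asboolP; eexists; exact: scale_cps_wedge.
Qed.

Lemma H_smulE h g : H_smul h (piH g) = piH (gps_mul (sincl h) g).
Proof.
apply: qmapE; first exact: gps_mulB.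
move=> _ /asboolP[eta ->]; apply/asboolP; exists (fun i => gps_mul (sincl h) (eta i)).
apply/val_inj; rewrite [RHS]val_gps_tw [LHS]/= val_gps_tw ftw_mul //.
by move=> i; exact: (cder_sincl i h).
Qed.

Lemma Om_smulE h g : Om_smul h (piO g) = piO (cps_mul (sincl h) g).
Proof.
apply: qmapE; first exact: cps_mulB.
move=> _ /asboolP[eta ->]; apply/asboolP; exists (fun i => cps_mul (sincl h) (eta i)).
rewrite /cps_wedge (morph_sum _ _ (@cps_mulB _ _ _)); apply: eq_bigr => i _.
exact/val_inj/cmulCA.
Qed.

Lemma H_uE g : H_u (piH g) = piH (gps_u g).
Proof.
apply: qmapE; first exact: gps_uB.
move=> _ /asboolP[eta ->]; apply/asboolP; exists (fun i => gps_u (eta i)).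
by apply/val_inj; rewrite [RHS]val_gps_tw [LHS]/= val_gps_tw ftw_u.
Qed.

Lemma H_tE g : H_t (piH g) = piH (gps_mul F g + gps_u2du g).
Proof.
apply: qmapE.
  by move=> x y; rewrite gps_mulB gps_u2duB opprD addrACA.
move=> _ /asboolP[eta ->]; apply/asboolP.
exists (fun i => gps_mul F (eta i) + gps_u2du (eta i) + gps_u (eta i)).
by apply/val_inj; rewrite [RHS]val_gps_tw [LHS]/= val_gps_tw ftw_t.
Qed.

Lemma G_uinvE g : G_uinv (piG g) = piG (lps_uinv g).
Proof.
apply: qmapE; first exact: lps_uinvB.
move=> _ /asboolP[eta ->]; apply/asboolP; exists (fun i => lps_uinv (eta i)).
by apply/val_inj; rewrite [RHS]val_lps_tw [LHS]/= val_lps_tw ftw_u.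
Qed.

Lemma G_dsE p g : G_ds p (piG g) =
  piG (lps_der (inr p) g - lps_uinv (lps_mul (cps_der (inr p) F) g)).
Proof.
apply: (qmapE (phi := fun g => lps_der (inr p) g - lps_uinv (lps_mul (cps_der (inr p) F) g))).
  by move=> x y; rewrite lps_derB lps_mulB lps_uinvB !opprD opprK addrACA.
move=> _ /asboolP[eta ->]; apply/asboolP.
exists (fun i => lps_der (inr p) (eta i)
                 - lps_uinv (lps_mul (cps_der (inr p) F) (eta i))).
by apply/val_inj; rewrite [RHS]val_lps_tw [LHS]/= val_lps_tw ftw_ds.
Qed.

Lemma H_inclE g : H_incl (piH g) = piG (lps_incl g).
Proof.
apply: qmapE; first exact: lps_inclB.
move=> _ /asboolP[eta ->]; apply/asboolP; exists (fun i => lps_incl (eta i)).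
by apply/val_inj; rewrite [RHS]val_lps_tw [LHS]/= val_gps_tw.
Qed.

Lemma H_projE g : H_proj (piH g) = piO (gps_proj g).
Proof.
apply: qmapE; first exact: gps_projB.
move=> _ /asboolP[eta ->]; apply/asboolP; exists (fun i => - gps_proj (eta i)).
rewrite /gps_tw (morph_sum _ _ (@gps_projB _ _)); apply: eq_bigr => i _.
rewrite gps_projB [gps_proj (gps_u _)](_ : _ = 0); last first.
  by apply/val_inj/funext => a; case: (gpsP (gps_der (inl i) (eta i))) => H _; exact: H.
rewrite -[- gps_proj (eta i)]sub0r cps_mulB.
have -> : cps_mul (cps_der (inl i) F) 0 = 0.
  by have := cps_mulB (cps_der (inl i) F) 0 0; rewrite !subrr.
by congr (_ - _); apply/val_inj.
Qed.

End WellDefined.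

Section RestrWellDefined.
Context {R : realType} {n : nat} {P : finType}.
Local Notation Y := (vars n P).
Local Notation X := (vars n void).

Definition ext0 (e : mexp X) : mexp Y := xs (xpart e) ezero.

Lemma ext0_inj : injective ext0.
Proof.
move=> a b /ffunP ab; apply/ffunP => -[i|[]].
by have := ab (inl i); rewrite !ffunE.
Qed.

Lemma restr_cmul (h g : mexp Y -> R[i]) :
  cmul h g \o ext0 = cmul (h \o ext0) (g \o ext0).
Proof.
apply/funext => e; rewrite /= !cmulE.
have E b c : ext0 (esub b c) = esub (ext0 b) (ext0 c).
  by apply/ffunP => -[i|p]; rewrite !ffunE.
under [RHS]eq_bigr => b _ do rewrite /= E.
rewrite -(big_map ext0 xpredT (fun b => h b * g (esub (ext0 e) b))).
apply: perm_big; apply: uniq_perm; rewrite ?map_inj_uniq ?below_uniq //.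
  exact: ext0_inj.
move=> b; rewrite mem_below; apply/eleP/mapP => [be|[c]].
  exists (xs (xpart b) ezero).
    rewrite mem_below; apply/eleP => -[i|[]]; rewrite !ffunE.
    by have := be (inl i); rewrite !ffunE.
  apply/ffunP => -[i|p]; rewrite !ffunE //.
  by have := be (inr p); rewrite !ffunE leqn0 => /eqP.
rewrite mem_below => /eleP ce -> -[i|p]; rewrite !ffunE //.
Qed.

Lemma restr_cder (i : 'I_n.+1) (h : mexp Y -> R[i]) :
  cder (inl i) h \o ext0 = cder (inl i) (h \o ext0).
Proof.
apply/funext => e; rewrite /cder /= !ffunE; congr (_ * h _).
by apply/ffunP => -[j|p]; rewrite !ffunE // addn0.
Qed.

Variable F : cps R Y.
Local Notation f := (cps_restr F).

Lemma gps_restr_tw eta : gps_restr (gps_tw F eta) = gps_tw f (fun i => gps_restr (eta i)).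
Proof.
rewrite /gps_tw (morph_sum _ _ (@gps_restrB _ _ _)); apply: eq_bigr => i _.
rewrite gps_restrB; congr (_ - _); apply/val_inj/funext => a; apply/funext => j.
  exact: (congr1 (fun k => k a) (restr_cder i (gps_val (eta i) ^~ (j - 1)))).
rewrite [RHS](_ : _ = cmul (cder (inl i) (cps_val F \o ext0))
                           ((gps_val (eta i) ^~ j) \o ext0) a) //.
by rewrite -restr_cder -restr_cmul.
Qed.

Lemma cps_restr_wedge eta :
  cps_restr (cps_wedge F eta) = cps_wedge f (fun i => cps_restr (eta i)).
Proof.
rewrite /cps_wedge (morph_sum _ _ (@cps_restrB _ _ _)); apply: eq_bigr => i _.
apply/val_inj/funext => a.
rewrite [RHS](_ : _ = cmul (cder (inl i) (cps_val F \o ext0))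
                           (cps_val (eta i) \o ext0) a) //.
by rewrite -restr_cder -restr_cmul.
Qed.

Lemma H_restrE g : H_restr f (\pi_(brieskorn F) g) = \pi_(brieskorn f) (gps_restr g).
Proof.
apply: qmapE; first exact: gps_restrB.
move=> _ /asboolP[eta ->]; apply/asboolP; eexists; exact: gps_restr_tw.
Qed.

Lemma Om_restrE g : Om_restr f (\pi_(jacobian F) g) = \pi_(jacobian f) (cps_restr g).
Proof.
apply: qmapE; first exact: cps_restrB.
move=> _ /asboolP[eta ->]; apply/asboolP; eexists; exact: cps_restr_wedge.
Qed.

End RestrWellDefined.

Lemma restr_pham (R : realType) (n : nat) (m : 'I_n.+1 -> nat) :
  cps_restr (pham_F m R) = pham_f m R.
Proof.
rewrite /pham_F (morphD (@cps_restrB _ _ _)).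
rewrite [X in _ + X](morph_sum _ _ (@cps_restrB _ _ _)) [X in _ + X]big1 ?addr0.
  rewrite (morph_sum _ _ (@cps_restrB _ _ _)); apply: eq_bigr => i _.
  apply/val_inj/funext => e; congr (_%:R); congr nat_of_bool.
  apply/eqP/eqP => [/ffunP H|->]; apply/ffunP => -[j|p] //; rewrite ?ffunE //.
  by have := H (inl j); rewrite !ffunE.
move=> nu _; apply/val_inj/funext => e.
rewrite [LHS](_ : _ = (xs (xpart e) ezero == xs (gexp nu) (eunit nu))%:R) //.
by case: eqP => // /ffunP/(_ (inr nu)); rewrite !ffunE eqxx.
Qed.

(* Main.v *)
Require Import Defs.
From mathcomp Require Import all_boot all_order all_algebra.
From mathcomp Require Import complex generic_quotient ring_quotient ring zify.
From mathcomp Require Import all_classical all_reals.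

Set Implicit Arguments.
Unset Strict Implicit.
Unset Printing Implicit Defensive.

Import Order.TTheory GRing.Theory Num.Theory.
Local Open Scope ring_scope.
Local Open Scope quotient_scope.

(** Multiplication by [exp (-(F - f)/u)] turns the Gauss-Manin connection along
the parameters into the partial derivatives [d/ds_nu], so the values at [s = 0] of
the iterated derivatives [G_dss l w] are, up to factorials, the Taylor
coefficients of the flat expansion of [w], with values in the Gauss-Manin system
of [f].  Modulo [m_0^(k+1)], a class of the Brieskorn lattice is determined by
its Taylor coefficients of order at most [k] modulo [u^-1 I_0[u^-1]].

This holds because the lattice of [f] meets [u^-1 I_0[u^-1]] in zero
([lattice_opposite]): if the representative of a class starts in order [j] and its
coefficients of order [j] lie in [u^-1 I_0[u^-1]], then these coefficients are
exact, and subtracting lifts of their primitives raises the order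
([s_order_step]); a representative of order [k+1] lies in [m_0^(k+1)]
([s_order_mpow]).

The Taylor coefficients of positive order of the primitive form lie in
[u^-1 I_0[u^-1]] ([primitive_low]).  Indeed the space [I_S[u^-1]] is stable under
the connection and restricts to [I_0[u^-1]] at [s = 0], and the first derivatives
of the primitive form lie in [u^-1 I_S].

The coefficients of the sum in the statement follow from expanding
[exp (-(F - f)/u)] and from reducing the monomials by
[x^p = (p_i - m_i + 1)/m_i * u * x^p / x_i^(m_i)] ([mono_reduce]): the
coefficient of [s^a] is a multiple of [u^(e_a) [x^(r(a))]], which is zero or lies
in [u^-1 I_0[u^-1]] unless [a] is in [A'_k], and for [a] in [A'_k] the recursion
says exactly that the multiple is zero for nonzero [a] and is one for [a = 0]
([coef_sum]).  Thus the sum and the primitive form have the same Taylor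
coefficients modulo [u^-1 I_0[u^-1]] up to order [k]. *)
(** * Reindexing series of Gevrey type *)

Section Reindexing.
Context {R : realType} {Y Z : finType}.
Local Notation C := R[i].

(** Lowering the radius to at most 1 absorbs a bounded change of degree. *)
Lemma gevrey_reindex (e : mexp Z -> mexp Y) (P : pred (mexp Z)) (c : nat)
    (g : mexp Y -> int -> C) :
    (forall a, P a -> (edeg (e a) <= edeg a + c)%N) ->
  gevrey g -> gevrey (fun a j => if P a then g (e a) j else 0).
Proof.
move=> He /gevreyP[g0 [r [M [r0 M0 HM]]]]; apply/gevreyP; split=> [a j j0|].
  by case: ifP => // _; exact: g0.
pose s := Num.min r 1; have s0 : 0 < s by rewrite lt_min r0 ltr01.
have s1 : s <= 1 by rewrite ge_min lexx orbT.
exists s, (M / s ^+ c); split=> // [|a k].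
  by rewrite divr_ge0 // exprn_ge0 // ltW.
case: ifP => Pa; last first.
  by rewrite Normc.normc0 mul0r mulr_ge0 // divr_ge0 // exprn_ge0 // ltW.
rewrite mulrAC ler_pdivlMr ?exprn_gt0 // -mulrA -exprD.
have HMs : Normc.normc (g (e a) k) * s ^+ (edeg (e a) + k) <= M * k`!%:R.
  by apply: expr_min (HM (e a) k); rewrite ?normc_ge0 ?ge_min ?lexx.
apply: le_trans HMs; rewrite ler_wpM2l ?normc_ge0 //.
apply: ler_wiXn2l; rewrite ?(ltW s0) //.
by have := He _ Pa; lia.
Qed.

End Reindexing.

(** * Reduction in one variable *)

Section OneVariable.
Context {R : realType} {Y : finType}.
Local Notation C := R[i].
Local Notation fl := (mexp Y -> int -> C).
Implicit Types (g : fl) (e : mexp Y) (j : int).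

Definition sgl (y : Y) (c : nat) : mexp Y := [ffun z => if z == y then c else 0%N].

Lemma edeg_sgl y c : edeg (sgl y c) = c.
Proof.
rewrite /edeg (bigD1 y) //= ffunE eqxx big1 ?addn0 // => z zy.
by rewrite ffunE (negPf zy).
Qed.

Lemma sgl1 y : sgl y 1 = eunit y.
Proof. by apply/ffunP => z; rewrite !ffunE; case: (z == y). Qed.

Lemma eadd_sgl y c d e : eadd (eadd e (sgl y c)) (sgl y d) = eadd e (sgl y (c + d)).
Proof. by apply/ffunP => z; rewrite !ffunE; case: (z == y); lia. Qed.

Lemma eadd_sgl0 y e : eadd e (sgl y 0) = e.
Proof. by apply/ffunP => z; rewrite !ffunE; case: (z == y); rewrite addn0. Qed.

Lemma eadd_sglE y c e : eadd e (sgl y c) y = (e y + c)%N.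
Proof. by rewrite !ffunE eqxx. Qed.

Definition bounded0 g : Prop := forall e j, j < 0 -> g e j = 0.

(** The component of [ud - df^] in the direction of [y] when [df/dy = m y^(m-1)]. *)
Definition tw1 y (m : nat) g : fl := fun e j =>
  (e y).+1%:R * g (eadd e (sgl y 1)) (j - 1) -
  (if (m.-1 <= e y)%N then m%:R * g (esub e (sgl y m.-1)) j else 0).

(** The scalar by which [y^(d + l m)] reduces to [u^l y^d] under repeated use of
    [y^(p + m) = (p + 1)/m * u y^p]. *)
Definition red_coef (m d l : nat) : C := \prod_(k < l) ((d + k * m).+1%:R / m%:R).

(** All monomials [y^(d + l m)] are reduced to [y^d] at once. As [g] has no
    negative powers of [u], only [l <= j] contribute. *)
Definition red_sum y m g : fl := fun e j =>
  \sum_(l < `|j|%N.+1) red_coef m (e y) l * g (eadd e (sgl y (l * m))) (j - l%:Z).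

Lemma red_sum0 y m g : bounded0 g -> bounded0 (red_sum y m g).
Proof.
move=> g0 e j j0; rewrite /red_sum big1 // => l _; rewrite g0 ?mulr0 //; lia.
Qed.

Lemma red_coefS m d l :
  red_coef m d l.+1 = d.+1%:R / m%:R * red_coef m (d + m) l.
Proof.
rewrite /red_coef big_ord_recl /= mul0n addn0; congr (_ * _).
by apply: eq_bigr => k _; rewrite /bump /= add1n mulSn addnA.
Qed.

Lemma red_sumE y m g e j : bounded0 g ->
  red_sum y m g e j =
  g e j + (e y).+1%:R / m%:R * red_sum y m g (eadd e (sgl y m)) (j - 1).
Proof.
move=> g0; have [j0|j0] := ltP j 0.
  by rewrite !red_sum0 ?g0 ?mulr0 ?addr0 //; lia.
case: j j0 => // k _; rewrite /red_sum big_ord_recl /= {1}/red_coef big_ord0 mul1r.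
rewrite mul0n eadd_sgl0 subr0; congr (_ + _); case: k => [|k].
  by rewrite big_ord0 sub0r big1 ?mulr0 // => l _; rewrite g0 ?mulr0 //; lia.
rewrite mulr_sumr (_ : `|k.+1%:Z - 1|%N = k); last by lia.
apply: eq_bigr => l _; rewrite /bump /= add1n red_coefS eadd_sglE mulrA.
congr (_ * g _ _); last by lia.
by rewrite eadd_sgl mulSn.
Qed.

(** The recursion expresses [red_sum] as the inverse of [1 - A] with [A]
    raising the power of [u], so it has no other solution that is bounded
    below in [u]. *)
Lemma red_sum_uniq y m g x : bounded0 g -> bounded0 x ->
    (forall e j, x e j =
      g e j + (e y).+1%:R / m%:R * x (eadd e (sgl y m)) (j - 1)) ->
  forall e j, x e j = red_sum y m g e j.
Proof.
move=> g0 x0 Hx; suff H (N : nat) e j : j < N%:Z -> x e j = red_sum y m g e j.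
  by move=> e j; apply: (H `|j|%N.+1); lia.
elim: N e j => [|N IH] e j jN; first by rewrite x0 // red_sum0.
by rewrite Hx red_sumE // IH //; lia.
Qed.

Lemma tw1_bounded y m g : bounded0 g -> bounded0 (tw1 y m g).
Proof.
move=> g0 e j j0; rewrite /tw1 g0; last by lia.
by rewrite g0 // !mulr0 if_same subr0.
Qed.

Lemma red_sum_tw1 y m g e j : bounded0 g -> (0 < m)%N ->
  red_sum y m (tw1 y m g) e j =
  - (if (m.-1 <= e y)%N then m%:R * g (esub e (sgl y m.-1)) j else 0).
Proof.
move=> g0 m0; apply/esym.
pose x e j : C := - (if (m.-1 <= e y)%N then m%:R * g (esub e (sgl y m.-1)) j else 0).
apply: (red_sum_uniq (x := x)); first exact: tw1_bounded.
  by move=> {}e {}j j0; rewrite /x g0 // mulr0 if_same oppr0.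
move=> {}e {}j; rewrite /x /tw1 eadd_sglE (_ : (m.-1 <= e y + m)%N = true); last by lia.
have -> : esub (eadd e (sgl y m)) (sgl y m.-1) = eadd e (sgl y 1).
  by apply/ffunP => z; rewrite !ffunE; case: (z == y); lia.
have m0' : m%:R != 0 :> C by rewrite pnatr_eq0 -lt0n.
by rewrite mulrN mulrA divfK //; ring.
Qed.

Lemma red_sum_tw1_comm y z m m' g e j : y != z -> bounded0 g ->
  red_sum y m (tw1 z m' g) e j = tw1 z m' (red_sum y m g) e j.
Proof.
move=> yz g0; apply/esym.
apply: (red_sum_uniq (x := tw1 z m' (red_sum y m g))); first exact: tw1_bounded.
  exact/tw1_bounded/red_sum0.
move=> {}e {}j; rewrite /tw1 (red_sumE y m (eadd e (sgl z 1)) _ g0).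
rewrite (red_sumE y m (esub e (sgl z m'.-1)) _ g0).
have zE c : eadd e (sgl y c) z = e z by rewrite !ffunE eq_sym (negPf yz) addn0.
have yE c : eadd e (sgl z c) y = e y by rewrite !ffunE (negPf yz) addn0.
have yE' c : esub e (sgl z c) y = e y by rewrite !ffunE (negPf yz) subn0.
rewrite zE yE yE'.
have -> : eadd (eadd e (sgl z 1)) (sgl y m) = eadd (eadd e (sgl y m)) (sgl z 1).
  by apply/ffunP => w; rewrite !ffunE addnAC.
have -> : esub (eadd e (sgl y m)) (sgl z m'.-1) = eadd (esub e (sgl z m'.-1)) (sgl y m).
  apply/ffunP => w; rewrite !ffunE; have [->|_] := eqVneq w y; last by rewrite !addn0.
  by rewrite (negPf yz) !subn0.
by case: ifP => _; ring.
Qed.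

(** Division with remainder by [tw1]: [red_rem] is the normal form, with
    exponents of [y] below [m - 1], and [red_div] a primitive of the rest. *)
Definition red_div y m g : fl := fun e j =>
  - m%:R^-1 * red_sum y m g (eadd e (sgl y m.-1)) j.

Definition red_rem y m g : fl := fun e j =>
  if (e y < m.-1)%N then red_sum y m g e j else 0.

Lemma red_divP y m g e j : bounded0 g -> (0 < m)%N ->
  g e j = red_rem y m g e j + tw1 y m (red_div y m g) e j.
Proof.
move=> g0 m0; rewrite /tw1 /red_div /red_rem eadd_sgl add1n prednK //.
have m0' : m%:R != 0 :> C by rewrite pnatr_eq0 -lt0n.
have := red_sumE y m e j g0; case: leqP => le_m H.
  have -> : eadd (esub e (sgl y m.-1)) (sgl y m.-1) = e.
    apply/ffunP => z; rewrite !ffunE; case: eqP => [->|_].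
      by rewrite subnK.
    by rewrite subn0 addn0.
  by rewrite H; field.
by rewrite H; field.
Qed.

Lemma red_rem_tw1 y m g e j : bounded0 g -> (0 < m)%N ->
  red_rem y m (tw1 y m g) e j = 0.
Proof.
move=> g0 m0; rewrite /red_rem red_sum_tw1 //; case: leqP => _ //.
by rewrite oppr0.
Qed.

Lemma red_rem_tw1_comm y z m m' g e j : y != z -> bounded0 g ->
  red_rem y m (tw1 z m' g) e j = tw1 z m' (red_rem y m g) e j.
Proof.
move=> yz g0; rewrite /red_rem red_sum_tw1_comm // /tw1.
rewrite !ffunE (negPf yz) addn0 subn0.
by case: ifP => // _; rewrite !mulr0 if_same subr0.
Qed.

Lemma red_rem_id y m g e j : bounded0 g ->
    (forall e j, (m.-1 <= e y)%N -> g e j = 0) -> (0 < m)%N ->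
  red_rem y m g e j = g e j.
Proof.
move=> g0 H m0; rewrite /red_rem; case: ltnP => em; last by rewrite H.
rewrite red_sumE // [X in _ * X]big1 ?mulr0 ?addr0 // => l _.
by rewrite H ?mulr0 // !eadd_sglE; lia.
Qed.

Lemma bin_le_exp2 n k : ('C(n, k) <= 2 ^ n)%N.
Proof.
elim: n k => [|n IH] [|k]; rewrite ?bin0n ?bin0 ?expn_gt0 //.
by rewrite binS expnS mul2n -addnn leq_add.
Qed.

Lemma red_coef_le m d l : (0 < m)%N ->
  Normc.normc (red_coef m d l) <= (2 ^ (d + l) * l`!)%N%:R.
Proof.
move=> m0; apply: (@le_trans _ _ ((d + l) ^_ l)%N%:R); last first.
  by rewrite ler_nat -bin_ffact leq_mul ?bin_le_exp2.
elim: l => [|l IH]; first by rewrite /red_coef big_ord0 Normc.normc1.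
rewrite /red_coef big_ord_recr /= Normc.normcM addnS ffactSS natrM [leRHS]mulrC.
apply: ler_pM; rewrite ?normc_ge0 //.
rewrite Normc.normcM Normc.normcV !normc_nat.
rewrite ler_pdivrMr ?ltr0n // -natrM ler_nat; nia.
Qed.

(** The factorials match: [red_coef] grows like [l!] while the coefficient that
    it multiplies grows like [(k - l)!], and [l! (k - l)! <= k!]. *)
Lemma gevrey_red_sum y m g : (0 < m)%N -> gevrey g -> gevrey (red_sum y m g).
Proof.
move=> m0 /gevreyP[g0 [r [M [r0 M0 HM]]]]; apply/gevreyP; split=> [a j j0|].
  exact: red_sum0.
pose s := Num.min r 1; have s0 : 0 < s by rewrite lt_min r0 ltr01.
have s1 : s <= 1 by rewrite ge_min lexx orbT.
have {}HM a (k : nat) : Normc.normc (g a k) * s ^+ (edeg a + k) <= M * k`!%:R.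
  by apply: expr_min (HM a k); rewrite ?normc_ge0 ?ge_min ?lexx.
(* one factor 1/2 pays for the powers of 2 in [red_coef_le], the other one for
   the number of summands *)
pose t := s ^+ m / 2 / 2; have t0 : 0 < t by rewrite !divr_gt0 ?exprn_gt0.
exists t, M; split=> // a k.
apply: (@le_trans _ _ (\sum_(l < k.+1) (M * k`!%:R * 2^-1 ^+ (edeg a + k)))).
  apply: (@le_trans _ _ (\sum_(l < k.+1) (Normc.normc (red_coef m (a y) l *
      g (eadd a (sgl y (l * m))) (k%:Z - l%:Z)) * t ^+ (edeg a + k)))).
    by rewrite -mulr_suml ler_wpM2r ?exprn_ge0 ?(ltW t0) // normc_sum.
  apply: ler_sum => l _; have lk : (l <= k)%N by rewrite -ltnS.
  rewrite subzn // Normc.normcM !expr_half mulrA ler_wpM2r ?exprn_ge0 ?invr_ge0 //.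
  set x := Normc.normc (g _ _).
  have Hx : x * s ^+ m ^+ (edeg a + k) <= M * (k - l)`!%:R.
    apply: le_trans (HM (eadd a (sgl y (l * m))) (k - l)%N).
    rewrite ler_wpM2l ?normc_ge0 // -exprM; apply: ler_wiXn2l; rewrite ?(ltW s0) //.
    rewrite edeg_eadd edeg_sgl mulnDr -addnA; apply: leq_add.
      by rewrite leq_pmull.
    by rewrite -[X in (_ <= m * X)%N](subnKC lk) mulnDr [(l * m)%N]mulnC leq_add2l leq_pmull.
  have al : ((a y + l <= edeg a + k)%N) by rewrite leq_add ?leq_edeg.
  have cl : Normc.normc (red_coef m (a y) l) * 2^-1 ^+ (edeg a + k) <= l`!%:R.
    rewrite exprVn ler_pdivrMr ?exprn_gt0 //; apply: le_trans (red_coef_le _ _ m0) _.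
    rewrite -natrX -natrM ler_nat mulnC leq_mul2l.
    by rewrite leq_exp2l // al orbT.
  apply: (@le_trans _ _ (l`!%:R * (M * (k - l)`!%:R))).
    rewrite [leLHS](_ : _ = Normc.normc (red_coef m (a y) l) *
        2^-1 ^+ (edeg a + k) * (x * s ^+ m ^+ (edeg a + k))); last by ring.
    by rewrite ler_pM // !mulr_ge0 ?normc_ge0 ?exprn_ge0 ?invr_ge0 // ltW.
  rewrite mulrCA ler_wpM2l // -natrM ler_nat -(bin_fact lk).
  by rewrite leq_pmull // bin_gt0.
rewrite sumr_const card_ord -mulrnAr -[leRHS]mulr1 ler_wpM2l ?mulr_ge0 //.
by rewrite -mulr_natl nat_half // leq_addl.
Qed.

Lemma gevrey_red_div y m g : (0 < m)%N -> gevrey g -> gevrey (red_div y m g).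
Proof.
move=> m0 gG; have := gevrey_red_sum y m0 gG.
move=> /(gevrey_reindex (e := fun e => eadd e (sgl y m.-1)) (P := predT) (c := m.-1)) H.
have {}H := gevreyD (- m%:R^-1) (H _) gevrey0; rewrite addr0 in H.
by apply: H => a _; rewrite edeg_eadd edeg_sgl.
Qed.

End OneVariable.

(** * Monomials *)

Section Monomials.
Context {R : realType} {Y : finType}.
Local Notation C := R[i].
Local Notation fl := (mexp Y -> int -> C).

Lemma fl_sumE (I : Type) (s : seq I) (P : pred I) (G : I -> fl) e j :
  (\sum_(i <- s | P i) G i) e j = \sum_(i <- s | P i) G i e j.
Proof. by elim/big_rec2: _ => // i x y _ <-. Qed.

Lemma cps_sumE (I : Type) (s : seq I) (P : pred I) (G : I -> cps R Y) e :
  (\sum_(i <- s | P i) G i) e = \sum_(i <- s | P i) G i e.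
Proof. by elim/big_rec2: _ => // i x y _ <-. Qed.

Lemma gps_sumE (I : Type) (s : seq I) (P : pred I) (G : I -> gps R Y) e j :
  (\sum_(i <- s | P i) G i) e j = \sum_(i <- s | P i) G i e j.
Proof. by elim/big_rec2: _ => // i x y _ <-. Qed.

Lemma lps_sumE (I : Type) (s : seq I) (P : pred I) (G : I -> lps R Y) e j :
  (\sum_(i <- s | P i) G i) e j = \sum_(i <- s | P i) G i e j.
Proof. by elim/big_rec2: _ => // i x y _ <-. Qed.

Lemma cmul_mono (c : mexp Y) (h : mexp Y -> C) a :
  cmul (cmono c) h a = if ele c a then h (esub a c) else 0.
Proof.
rewrite cmulE /cmono; case: ifP => ca.
  rewrite (bigD1_seq c) ?mem_below ?below_uniq //= eqxx mul1r big1 ?addr0 //.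
  by move=> b /negPf ->; rewrite mul0r.
rewrite big_seq big1 // => b; rewrite mem_below.
by case: eqP => [->|_]; rewrite ?ca // mul0r.
Qed.

Lemma lmul_mono (c : mexp Y) (g : fl) a j :
  lmul (cmono c) g a j = if ele c a then g (esub a c) j else 0.
Proof. exact: cmul_mono. Qed.

Lemma lmulZl (c : C) (h : mexp Y -> C) (g : fl) a j :
  lmul (fun b => c * h b) g a j = c * lmul h g a j.
Proof. by rewrite /lmul /cmul mulr_sumr; apply: eq_bigr => b _; rewrite mulrA. Qed.

Lemma laurent_shift (e : int) (g : fl) : gevrey_laurent g -> gevrey_laurent (ushift e g).
Proof.
move=> Hg; case: e => k.
  elim: k => [|k IH]; first by rewrite ushift0.
  by rewrite -add1n PoszD -ushiftD; exact: laurent_u.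
elim: k => [|k IH]; first exact: laurent_uinv.
rewrite (_ : Negz k.+1 = -1 + Negz k); last by lia.
by rewrite -ushiftD; exact: laurent_uinv.
Qed.

Definition lps_mono (e : mexp Y) (j : int) : lps R Y :=
  lps_mk (laurent_shift j (laurent_gevrey ((cincl_gevrey _).2 (convergent_mono e)))).

Lemma lps_monoE e j a k : lps_mono e j a k = ((a == e) && (k == j))%:R.
Proof.
rewrite /= /ushift /cincl /cmono subr_eq0.
by case: (k == j); rewrite ?andbT ?andbF.
Qed.

End Monomials.
Arguments lps_mono {R Y} e j.

(** * The Gauss-Manin system of the unperturbed Brieskorn-Pham polynomial *)

Section Unperturbed.
Context {R : realType} {n : nat}.
Variable m : 'I_n.+1 -> nat.
Hypothesis hm : forall i, (2 <= m i)%N.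
Local Notation C := R[i].
Local Notation X := (vars n void).
Local Notation fl := (mexp X -> int -> C).
Local Notation f := (pham_f m R).
Local Notation piG := (\pi_(gauss_manin f)).

Let m_gt0 i : (0 < m i)%N. Proof. exact: leq_trans (hm i). Qed.

Definition xv (i : 'I_n.+1) : X := inl i.

Lemma cder_pham i a :
  cder (inl i) f a = (m i)%:R * cmono (sgl (xv i) (m i).-1) a.
Proof.
have xsE k : xs [ffun j => if j == k then m k else 0%N] (ezero : mexp void)
    = sgl (xv k) (m k) by apply/ffunP => -[j|[]]; rewrite !ffunE.
rewrite /cder /pham_f cps_sumE.
rewrite (eq_bigr (fun k => (eadd a (eunit (inl i)) == sgl (xv k) (m k))%:R)); last first.
  by move=> k _; rewrite xsE.
rewrite (bigD1 i) //= big1 ?addr0; last first.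
  move=> k ki; case: eqP => // /ffunP /(_ (inl i)); rewrite !ffunE eqxx addn1.
  by rewrite eq_sym (inj_eq inl_inj) (negPf ki).
rewrite /cmono; have -> : (eadd a (eunit (inl i)) == sgl (xv i) (m i)) =
    (a == sgl (xv i) (m i).-1).
  rewrite -sgl1; apply/eqP/eqP => [/ffunP H|->].
    apply/ffunP => z; have := H z; rewrite !ffunE /xv; have := m_gt0 i.
    by case: (z == _) => _; rewrite ?addn1 ?addn0 // => <-.
  apply/ffunP => z; rewrite !ffunE /xv; have := m_gt0 i.
  by case: (z == _); rewrite ?addn0 ?addn1 // => /prednK.
case: eqP => [->|_]; last by rewrite !mulr0.
by rewrite ffunE eqxx prednK.
Qed.

Lemma ele_sgl (Y : finType) (y : Y) c (e : mexp Y) : ele (sgl y c) e = (c <= e y)%N.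
Proof.
apply/eleP/idP => [/(_ y)|cy z]; rewrite ffunE; first by rewrite eqxx.
by case: eqP => [->|].
Qed.

Lemma ftw_pham (eta : 'I_n.+1 -> fl) e j :
  ftw f eta e j = \sum_i tw1 (xv i) (m i) (eta i) e j.
Proof.
rewrite /ftw fl_sumE; apply: eq_bigr => i _; rewrite /tw1 sgl1.
rewrite [LHS](_ : _ = (e (inl i)).+1%:R * eta i (eadd e (eunit (inl i))) (j - 1) -
  lmul (cder (inl i) f) (eta i) e j) //.
congr (_ - _); rewrite (_ : cder _ _ = fun a => (m i)%:R *
   (cmono (sgl (xv i) (m i).-1) a)); last by apply/funext => a; exact: cder_pham.
by rewrite lmulZl lmul_mono ele_sgl; case: ifP; rewrite ?mulr0.
Qed.

Lemma gps_tw_pham (eta : 'I_n.+1 -> gps R X) e j :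
  gps_tw f eta e j = \sum_i tw1 (xv i) (m i) (eta i) e j.
Proof. by rewrite val_gps_tw ftw_pham. Qed.

Lemma lps_tw_pham (eta : 'I_n.+1 -> lps R X) e j :
  lps_tw f eta e j = \sum_i tw1 (xv i) (m i) (eta i) e j.
Proof. by rewrite val_lps_tw ftw_pham. Qed.

Lemma gps_bounded0 (g : gps R X) : bounded0 g.
Proof. by case: (gpsP g). Qed.

Lemma in_GamP (e : mexp 'I_n.+1) :
  reflect (forall i, (e i < (m i).-1)%N) (in_Gam m e).
Proof.
by apply: (iffP forallP) => H i; have := H i; have := hm i; lia.
Qed.

(** One variable after the other, [red_div] divides off the part of a series
    outside the span of the [x^nu] with [nu] in Gamma. *)
Lemma reduce_exact (g : gps R X) : exists eta : 'I_n.+1 -> gps R X,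
  forall e j, ~~ in_Gam m (xpart e) -> (g - gps_tw f eta) e j = 0.
Proof.
suff H (s : seq 'I_n.+1) : exists eta : 'I_n.+1 -> gps R X,
    forall (e : mexp X) j, has (fun i => (m i).-1 <= e (xv i))%N s -> (g - gps_tw f eta) e j = 0.
  have [eta Heta] := H (enum 'I_n.+1); exists eta => e j ne; apply: Heta.
  apply: contraR ne => /hasPn ne; apply/in_GamP => i.
  by have := ne i (mem_enum _ _); rewrite -ltnNge ffunE.
elim: s => [|i s [eta Heta]]; first by exists (fun=> 0).
set g1 := g - gps_tw f eta in Heta.
pose d : gps R X := gps_mk (gevrey_red_div (xv i) (m_gt0 i) (gpsP g1)).
exists (eta + (fun k => if k == i then d else 0)) => e j.
rewrite (morphD (@gps_twB _ _ _ _)) opprD addrA -/g1 => Hs.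
clearbody g1.
rewrite [LHS](_ : _ = g1 e j - gps_tw f (fun k => if k == i then d else 0) e j) //.
rewrite gps_tw_pham (bigD1 i) //= big1 ?addr0; last first.
  move=> k /negPf ki; rewrite ki /tw1 /=.
  by rewrite !mulr0 if_same subr0.
rewrite eqxx (red_divP (xv i) e j (gps_bounded0 g1) (m_gt0 i)) /= addrK.
rewrite /red_rem; case: ltnP => // ei.
rewrite /red_sum big1 // => l _; rewrite Heta ?mulr0 //.
move: Hs; rewrite /= leqNgt ei /=; apply: sub_has => k /=.
by rewrite ffunE => /leq_trans -> //; exact: leq_addr.
Qed.

(** [red_rem] in the variable [x_i] fixes [h] and kills the summand of index [i],
    while it commutes with the operators in the other variables. *)
Lemma exact_Gam0 (h : fl) (eta : 'I_n.+1 -> fl) :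
    bounded0 h -> (forall i, bounded0 (eta i)) ->
    (forall e j, ~~ in_Gam m (xpart e) -> h e j = 0) ->
    (forall e j, h e j = \sum_i tw1 (xv i) (m i) (eta i) e j) ->
  forall e j, h e j = 0.
Proof.
move=> h0 eta0 hG Hh.
suff H (s : seq 'I_n.+1) : exists2 eta : 'I_n.+1 -> fl, forall i, bounded0 (eta i) &
    forall e j, h e j = \sum_(i | i \notin s) tw1 (xv i) (m i) (eta i) e j.
  have [eta' _ H'] := H (enum 'I_n.+1) => e j; rewrite H' big1 // => i.
  by rewrite mem_enum.
elim: s => [|i s [eta' eta'0 IH]]; first by exists eta.
exists (fun k => red_rem (xv i) (m i) (eta' k)).
  move=> k e j j0; rewrite /red_rem; case: ifP => // _; exact: red_sum0.
move=> e j; rewrite -(red_rem_id e j h0 _ (m_gt0 i) (y := xv i)); last first.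
  move=> {}e {}j ei; rewrite hG //; apply/negP => /in_GamP /(_ i).
  by rewrite ffunE ltnNge ei.
transitivity (\sum_(k | k \notin s)
    red_rem (xv i) (m i) (tw1 (xv k) (m k) (eta' k)) e j).
  rewrite /red_rem; case: ifP => _; last by rewrite big1.
  rewrite /red_sum exchange_big /=; apply: eq_bigr => l _.
  by rewrite IH mulr_sumr.
rewrite [RHS](eq_bigl (fun k => (k \notin s) && (k != i))); last first.
  by move=> k; rewrite inE negb_or andbC.
rewrite [RHS]big_mkcondr; apply: eq_bigr => k _.
have [->|ki] := eqVneq k i; first by rewrite red_rem_tw1.
rewrite red_rem_tw1_comm //.
by apply: contraNneq ki => -[->].
Qed.

(** [low 0] is [I_0[u^-1]], and [low (-1)] is [u^-1 I_0[u^-1]]: a Laurent series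
    has only finitely many negative powers of [u]. *)
Definition low (b : int) (w : gauss_manin f) : Prop :=
  exists2 g : lps R X, w = piG g &
    forall e j, ~~ ((j <= b) && in_Gam m (xpart e)) -> g e j = 0.

Lemma lpsDE (g g' : lps R X) e j : (g + g') e j = g e j + g' e j.
Proof. by []. Qed.

Lemma low0 b : low b 0.
Proof. by exists 0 => //; rewrite raddf0. Qed.

Lemma lowD b w w' : low b w -> low b w' -> low b (w + w').
Proof.
move=> [g -> Hg] [g' -> Hg']; exists (g + g'); first by rewrite raddfD.
by move=> e j H; rewrite lpsDE Hg // Hg' // addr0.
Qed.

Lemma lowN b w : low b w -> low b (- w).
Proof.
move=> [g -> Hg]; exists (- g); first by rewrite raddfN.
by move=> e j H; rewrite [LHS](_ : _ = - g e j) // Hg // oppr0.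
Qed.

Lemma low_uinv b w : low b w -> low (b - 1) (G_uinv w).
Proof.
move=> [g -> Hg]; exists (lps_uinv g); first by rewrite G_uinvE.
move=> e j H; rewrite [LHS](_ : _ = g e (j - -1)) // Hg //.
by move: H; rewrite opprK lerBrDr.
Qed.

Lemma low_le b b' w : b <= b' -> low b w -> low b' w.
Proof.
move=> bb' [g -> Hg]; exists g => // e j H; apply: Hg; apply: contra H.
by case/andP=> /le_trans -> //.
Qed.

Lemma low_mono b (c : C) e j : j <= b -> in_Gam m (xpart e) ->
  low b (piG (c *: lps_mono e j)).
Proof.
move=> jb eG; exists (c *: lps_mono e j) => // e' j' H.
rewrite [LHS](_ : _ = c * lps_mono e j e' j') // lps_monoE.
by case: eqP H => [->|_]; case: eqP => [->|_]; rewrite ?jb ?eG ?mulr0.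
Qed.

(** After subtraction of an exact form, [g] is supported on Gamma, as is the
    representative in [u^-1 I_0[u^-1]]. By [exact_Gam0] the two agree, although
    one has only nonnegative and the other only negative powers of [u]. *)
Lemma lattice_opposite (g : gps R X) :
  low (-1) (piG (lps_incl g)) -> g \in gps_exact f.
Proof.
move=> [p pE Hp].
have /asboolP[eta etaE] : lps_incl g - p \in lps_exact f.
  by rewrite Quotient.idealrBE; apply/eqP.
have [eta1 Heta1] := reduce_exact g.
set h := g - gps_tw f eta1 in Heta1.
have hE e j : h e j = g e j - gps_tw f eta1 e j by [].
pose shift (N : nat) (q : fl) : fl := fun e j => q e (j - N%:Z).
(* a common power of [u] clears all denominators *)
have [N HN] : exists N : nat, bounded0 (shift N p) /\ forall i, bounded0 (shift N (eta i)).
  have lb (q : lps R X) : exists N : nat, forall j e, j < - N%:Z -> q e j = 0.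
    case: (lpsP q) => N [q0 _]; exists N => j e jN.
    have := q0 e (j + N%:Z); rewrite /ushift addrK; apply; lia.
  have [Np HNp] := lb p.
  have [Ne HNe] := choice (fun i => lb (eta i)).
  exists (Np + \sum_i Ne i)%N; split=> [e j j0|i e j j0].
    by apply: HNp; lia.
  apply: HNe; suff : (Ne i <= \sum_i Ne i)%N by lia.
  by rewrite (bigD1 i) //= leq_addr.
have h0 : forall e j, h e j = 0; last first.
  apply/asboolP; exists eta1; apply/eqP; rewrite -subr_eq0; apply/eqP/val_inj.
  by apply/funext => e; apply/funext => j; exact: h0.
clearbody h.
have hp : forall e j, h e (j - N%:Z) - p e (j - N%:Z) = 0.
  apply: (@exact_Gam0 _ (fun i => fun e j => eta i e (j - N%:Z) - eta1 i e (j - N%:Z))).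
  - move=> e j j0; rewrite [p _ _](HN.1 e j j0) subr0 (gps_bounded0 h) //; lia.
  - move=> i e j j0; rewrite [eta i _ _](HN.2 i e j j0) sub0r.
    by rewrite (gps_bounded0 (eta1 i)) ?oppr0 //; lia.
  - by move=> e j eG; rewrite Heta1 // Hp ?subrr // (negPf eG) andbF.
  move=> e j; have E : g e (j - N%:Z) - p e (j - N%:Z) =
      \sum_i tw1 (xv i) (m i) (eta i) e (j - N%:Z) by rewrite -lps_tw_pham -etaE.
  rewrite hE addrAC E gps_tw_pham -sumrB; apply: eq_bigr => i _.
  rewrite /tw1 (_ : j - 1 - N%:Z = j - N%:Z - 1); last by lia.
  by case: ifP => _; ring.
move=> e j; have := hp e (j + N%:Z); rewrite addrK.
have [j0|j0] := ltP j 0; first by rewrite (gps_bounded0 h).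
by rewrite Hp ?subr0 // negb_and -ltNge (lt_le_trans _ j0).
Qed.

End Unperturbed.

Lemma eadd_esub_sgl (Y : finType) (y : Y) c (a e : mexp Y) :
  (eadd a (sgl y 1) == esub e (sgl y c)) = (c < e y)%N && (a == esub e (sgl y c.+1)).
Proof.
apply/eqP/andP => [/ffunP H|[ce /eqP ->]]; last first.
  by apply/ffunP => z; rewrite !ffunE; case: eqP => [->|_]; lia.
split; first by have := H y; rewrite !ffunE eqxx /=; lia.
apply/eqP/ffunP => z; have := H z; rewrite !ffunE.
by case: (z == y) => /=; lia.
Qed.

Section UnperturbedMonomials.
Context {R : realType} {n : nat}.
Variable m : 'I_n.+1 -> nat.
Hypothesis hm : forall i, (2 <= m i)%N.
Local Notation C := R[i].
Local Notation X := (vars n void).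
Local Notation f := (pham_f m R).
Local Notation piG := (\pi_(gauss_manin f)).
Local Notation piH := (\pi_(brieskorn f)).

Let m_gt0 i : (0 < m i)%N. Proof. exact: leq_trans (hm i). Qed.

Lemma lps_exactZ (c : C) (g : lps R X) : g \in lps_exact f -> c *: g \in lps_exact f.
Proof.
move=> /asboolP[eta ->]; apply/asboolP; exists (fun i => c *: eta i).
apply/val_inj/funext => e; apply/funext => j.
rewrite [RHS](lps_tw_pham hm) [LHS](_ : _ = c * lps_tw f eta e j) //.
rewrite lps_tw_pham // mulr_sumr; apply: eq_bigr => i _.
rewrite /tw1; have cE a k : (c *: eta i) a k = c * eta i a k by [].
by rewrite !cE; case: ifP => _; ring.
Qed.

Lemma piG_scale (c : C) g g' : piG g = piG g' -> piG (c *: g) = piG (c *: g').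
Proof.
move=> /eqP; rewrite -Quotient.idealrBE => H; apply/eqP.
by rewrite -Quotient.idealrBE -scalerBr lps_exactZ.
Qed.

Lemma low_scale b (c : C) g : low b (piG g) -> low b (piG (c *: g)).
Proof.
move=> [g' E Hg]; exists (c *: g'); first exact: piG_scale.
by move=> e j H; rewrite [LHS](_ : _ = c * g' e j) // Hg // mulr0.
Qed.

(** The relation is the image of [x^e / x_i^(m_i - 1)] under [ud - df^]. *)
Lemma mono_step (e : mexp X) i j : ((m i).-1 <= e (xv i))%N ->
  piG (lps_mono e j) =
  piG (((e (xv i) - (m i).-1)%N%:R / (m i)%:R) *:
         lps_mono (esub e (sgl (xv i) (m i))) (j + 1)).
Proof.
move=> ei; have mi0 : (m i)%:R != 0 :> C by rewrite pnatr_eq0 -lt0n.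
apply/eqP; rewrite -Quotient.idealrBE.
pose h : lps R X := - (m i)%:R^-1 *: lps_mono (esub e (sgl (xv i) (m i).-1)) j.
apply/asboolP; exists (fun k => if k == i then h else 0).
apply/val_inj/funext => a; apply/funext => k.
rewrite [RHS](lps_tw_pham hm) (bigD1 i) //= big1 ?addr0; last first.
  by move=> l /negPf li; rewrite li /tw1 /= !mulr0 if_same subr0.
rewrite eqxx /tw1.
have hE b l : h b l = - (m i)%:R^-1 * ((b == esub e (sgl (xv i) (m i).-1)) && (l == j))%:R.
  by rewrite -lps_monoE.
rewrite !hE [LHS](_ : _ = lps_mono e j a k - (e (xv i) - (m i).-1)%N%:R / (m i)%:R *
  lps_mono (esub e (sgl (xv i) (m i))) (j + 1) a k) // !lps_monoE.
rewrite (_ : (k - 1 == j) = (k == j + 1)); last by rewrite subr_eq.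
have E1 : (if ((m i).-1 <= a (xv i))%N then (m i)%:R * (- (m i)%:R^-1 *
    ((esub a (sgl (xv i) (m i).-1) == esub e (sgl (xv i) (m i).-1)) && (k == j))%:R)
    else 0) = - ((a == e) && (k == j))%:R :> C.
  case: ifP => ai; last first.
    by case: eqP ai => [->|_]; rewrite ?ei ?oppr0.
  have -> : (esub a (sgl (xv i) (m i).-1) == esub e (sgl (xv i) (m i).-1)) = (a == e).
    apply/eqP/eqP => [/ffunP H|-> //]; apply/ffunP => z; have := H z.
    rewrite !ffunE; case: eqP => [->|_]; last by rewrite !subn0.
    by move=> H'; rewrite -(subnK ai) H' subnK.
  by rewrite mulrA mulrN divff // mulN1r.
rewrite E1 eadd_esub_sgl prednK //.
case: (eqVneq a (esub e (sgl (xv i) (m i)))) => [->|_]; last by rewrite andbF /= !mulr0; ring.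
rewrite andbT !ffunE eqxx; case: leqP => [le_e|lt_e]; last first.
  rewrite (_ : e (xv i) - (m i).-1 = 0)%N; last first.
    by apply/eqP; rewrite subn_eq0 -ltnS prednK.
  by rewrite !mul0r mulr0; ring.
have -> : (e (xv i) - (m i).-1 = (e (xv i) - m i).+1)%N.
  by rewrite -[in LHS]subn1 subnBA // addn1 subSn // -(prednK (m_gt0 i)).
by rewrite /=; field.
Qed.

(** The factor [p_i - m_i + 1] of [mono_step] vanishes. *)
Lemma mono_boundary (e : mexp X) i j : e (xv i) = (m i).-1 -> piG (lps_mono e j) = 0.
Proof.
by move=> ei; rewrite (@mono_step e i j) ei // subnn mul0r scale0r raddf0.
Qed.

Definition xexp (p : mexp 'I_n.+1) : mexp X := xs p ezero.

Definition mono_coef (p : mexp 'I_n.+1) : C :=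
  \prod_i \prod_(1 <= l < (p i %/ m i).+1) (((p i)%:R - (l * m i)%N%:R + 1) / (m i)%:R).

Lemma mono_reduce (p : mexp 'I_n.+1) j :
  piG (lps_mono (xexp p) j) =
  piG (mono_coef p *: lps_mono (xexp [ffun i => p i %% m i]%N)
                        (j + (\sum_i p i %/ m i)%N%:Z)).
Proof.
elim: {p}(edeg p) {-2}p (leqnn (edeg p)) j => [|N IH] p pN j.
  have p0 i : p i = 0%N by apply/eqP; rewrite -leqn0 (leq_trans (leq_edeg _ _)).
  rewrite /mono_coef big1 => [|i _]; last by rewrite p0 div0n big_nil.
  rewrite scale1r big1 ?addr0 => [|i _]; last by rewrite p0 div0n.
  by congr (piG (lps_mono (xexp _) _)); apply/ffunP => i; rewrite ffunE p0 mod0n.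
have [/forallP small|] := boolP [forall i, p i < m i]%N.
  rewrite /mono_coef big1 => [|i _]; last by rewrite divn_small // big_nil.
  rewrite scale1r big1 ?addr0 => [|i _]; last by rewrite divn_small.
  by congr (piG (lps_mono (xexp _) _)); apply/ffunP => i; rewrite ffunE modn_small.
rewrite negb_forall; case/existsP=> i; rewrite -leqNgt => pi.
pose p' : mexp 'I_n.+1 := [ffun k => if k == i then p k - m k else p k]%N.
have p'i : p' i = (p i - m i)%N by rewrite ffunE eqxx.
have p'k k : k != i -> p' k = p k by move=> /negPf ki; rewrite ffunE ki.
have lt_p : (edeg p' < edeg p)%N.
  rewrite /edeg (bigD1 i) //= [X in (_ < X)%N](bigD1 i) //= p'i.
  rewrite (eq_bigr (fun k => p k)) => [|k /p'k //].
  by rewrite ltn_add2r ltn_subrL m_gt0 (leq_trans _ pi).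
have xi : xexp p (xv i) = p i by rewrite !ffunE.
have le_pi : ((m i).-1 <= p i)%N by rewrite (leq_trans _ pi) // leq_pred.
rewrite (@mono_step _ i) ?xi // (_ : esub _ _ = xexp p'); last first.
  apply/ffunP => -[k|[]]; rewrite !ffunE /xv (inj_eq inl_inj).
  by case: eqP => [->|_]; rewrite ?subn0.
rewrite (piG_scale _ (IH p' _ _)); last by rewrite -ltnS (leq_trans lt_p).
rewrite scalerA; have divi : (p i %/ m i = (p' i %/ m i).+1)%N.
  by rewrite p'i -{1}(subnK pi) divnDr ?dvdnn // divnn m_gt0 addn1.
have -> : (p i - (m i).-1)%N%:R / (m i)%:R * mono_coef p' = mono_coef p.
  rewrite /mono_coef (bigD1 i) //= [RHS](bigD1 i) //= mulrA; congr (_ * _); last first.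
    by apply: eq_bigr => k ki; rewrite p'k.
  rewrite divi [RHS]big_nat_recl //= mul1n p'i; congr (_ / _ * _).
    by rewrite -subn1 subnBA // natrB ?natrD //; [ring|rewrite (leq_trans pi) ?leq_addr].
  apply: eq_bigr => l _; congr (_ / _).
  by rewrite natrB // mulSn natrD; ring.
congr (piG (_ *: lps_mono (xexp _) _)).
  apply/ffunP => k; rewrite !ffunE; case: eqP => [->|//].
  by rewrite -{2}(subnK pi) modnDr.
rewrite -addrA; congr (_ + _); rewrite (bigD1 i) //= [in RHS](bigD1 i) //= divi.
rewrite (eq_bigr (fun k => p k %/ m k)%N) => [|k ki]; last by rewrite p'k.
by rewrite addSn intS.
Qed.

(** Elements of the Jacobian ideal have no terms with exponent in Gamma, so the
    [x^nu] are linearly independent modulo this ideal. *)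
Lemma canonical_section1 (sigma0 : jacobian f -> brieskorn f) : canonical_section sigma0 ->
  sigma0 (Om_class f (cps_mono R ezero)) = piH (gps_incl (cps_mono R ezero)).
Proof.
move=> [_ sigmaK rangeE]; set w := Om_class _ _.
have [c cE] : exists c : Gam m -> C, sigma0 w =
    \sum_(nu : Gam m) H_scale (c nu) (H_class f (cps_mono R (xs (gexp nu) ezero))).
  by have : range sigma0 (sigma0 w) by [exists w]; rewrite rangeE.
pose h : cps R X := \sum_(nu : Gam m) c nu *: cps_mono R (xs (gexp nu) ezero).
have hE : sigma0 w = piH (gps_incl h).
  rewrite cE /h (_ : gps_incl _ = \sum_(nu : Gam m)
      c nu *: gps_incl (cps_mono R (xs (gexp nu) ezero))); last first.
    apply/val_inj/funext => e; apply/funext => j.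
    rewrite [RHS]gps_sumE [LHS](_ : _ = if j == 0 then h e else 0) // /h cps_sumE.
    case: eqP => [->|/eqP /negPf j0]; first by [].
    rewrite big1 // => nu _.
    by rewrite [LHS](_ : _ = c nu * (if j == 0 then (e == xs (gexp nu) ezero)%:R else 0)) // j0 mulr0.
  by rewrite raddf_sum; apply: eq_bigr => nu _; exact: H_scaleE.
have : h - cps_mono R ezero \in cps_exact f.
  rewrite Quotient.idealrBE; apply/eqP; have := sigmaK w; rewrite hE H_projE => wE.
  by rewrite [RHS](_ : _ = w) // -wE; congr (\pi_(jacobian f) _); apply/val_inj.
move=> /asboolP[eta etaE]; rewrite hE; congr (piH (gps_incl _)); apply/val_inj/funext => e.
apply/eqP; rewrite -subr_eq0; apply/eqP.
have [eG|eG] := boolP (in_Gam m (xpart e)).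
  rewrite [LHS](_ : _ = (h - cps_mono R ezero) e) // etaE cps_sumE big1 // => i _.
  rewrite [LHS](_ : _ = lmul (cder (inl i) f) (cincl (eta i)) e 0) //.
  rewrite (_ : cder _ _ = fun a => (m i)%:R *
     (cmono (sgl (xv i) (m i).-1) a)); last by apply/funext => a; exact: cder_pham.
  rewrite lmulZl lmul_mono ele_sgl; case: leqP => // ei; last by rewrite mulr0.
  by have /(in_GamP hm)/(_ i) := eG; rewrite ffunE ltnNge ei.
have h0 : h e = 0.
  rewrite /h cps_sumE big1 // => nu _.
  rewrite [LHS](_ : _ = c nu * (e == xs (gexp nu) ezero)%:R) //.
  case: eqP => [eE|_]; last by rewrite mulr0.
  case/negP: eG; apply/(in_GamP hm) => i; rewrite eE !ffunE; exact: ltn_ord.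
rewrite [LHS](_ : _ = h e - (e == ezero)%:R) // h0; case: eqP => [eE|_]; last by rewrite subr0.
by case/negP: eG; apply/(in_GamP hm) => i; rewrite eE !ffunE; have := hm i; lia.
Qed.

Lemma low_section (sigma0 : jacobian f -> brieskorn f) v : canonical_section sigma0 -> range sigma0 v ->
  low 0 (H_incl v).
Proof.
move=> [_ _ rangeE]; rewrite rangeE => -[c ->].
pose g : gps R X := \sum_(nu : Gam m) c nu *: gps_incl (cps_mono R (xs (gexp nu) ezero)).
have -> : \sum_(nu : Gam m) H_scale (c nu) (H_class f (cps_mono R (xs (gexp nu) ezero)))
    = piH g.
  by rewrite raddf_sum; apply: eq_bigr => nu _; exact: H_scaleE.
rewrite H_inclE; exists (lps_incl g) => // e j H.
rewrite [LHS](_ : _ = g e j) // /g gps_sumE big1 // => nu _.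
rewrite [LHS](_ : _ = c nu * (if j == 0 then (e == xs (gexp nu) ezero)%:R else 0)) //.
case: eqP H => [->|_]; last by rewrite mulr0.
case: eqP => [->|_]; last by rewrite mulr0.
by case/negP; apply/(in_GamP hm) => i; rewrite !ffunE; exact: ltn_ord.
Qed.
End UnperturbedMonomials.

(** * Taylor coefficients along the parameters *)

Section Filtration.
Context {R : realType} {n : nat} {P : finType}.
Local Notation C := R[i].
Local Notation Y := (vars n P).
Local Notation X := (vars n void).
Local Notation fl := (mexp Y -> int -> C).
Implicit Types (e : mexp Y) (a b : mexp P) (l : seq P).

Lemma xs_parts e : xs (xpart e) (spart e) = e.
Proof. by apply/ffunP => -[i|p]; rewrite !ffunE. Qed.

Lemma ele_esub_edeg b a : ele b a -> edeg a = edeg b -> a = b.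
Proof.
move=> ba E; have := ele_edeg ba; rewrite E -[X in _ = X]addn0 => /addnI sub0.
apply/ffunP => y; apply/eqP; rewrite eqn_leq (eleP _ _ ba) andbT -subn_eq0.
by have := leq_edeg (esub a b) y; rewrite sub0 leqn0 ffunE.
Qed.

Definition s_order (j : nat) (g : fl) : Prop :=
  forall e k, (edeg (spart e) < j)%N -> g e k = 0.

Variable F : cps R Y.

Definition nabla (p : P) (g : lps R Y) : lps R Y :=
  lps_der (inr p) g - lps_uinv (lps_mul (cps_der (inr p) F) g).
(** The iterated connection; at [s = 0] it gives the Taylor coefficients of
    [exp (-(F - f)/u) g], multiplied by factorials. *)
Definition nablas l (g : lps R Y) : lps R Y := foldl (fun (g : lps R Y) p => nabla p g) g l.
Definition G_dss l (w : gauss_manin F) : gauss_manin F :=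
  foldl (fun w p => G_ds p w) w l.

Lemma G_dssE l (g : lps R Y) :
  G_dss l (\pi_(gauss_manin F) g) = \pi_(gauss_manin F) (nablas l g).
Proof. by elim: l g => //= p l IH g; rewrite G_dsE -IH. Qed.

Lemma nablaB p : zmod_morphism (nabla p).
Proof.
by move=> x y; rewrite /nabla lps_derB lps_mulB lps_uinvB !opprD opprK addrACA.
Qed.

Lemma nablasB l : zmod_morphism (nablas l).
Proof. by elim: l => // p l IH x y; rewrite [LHS]/= nablaB; exact: IH. Qed.

Lemma G_dsB p : zmod_morphism (@G_ds R n P F p).
Proof.
move=> x y; rewrite -[x]reprK -[y]reprK -raddfB !G_dsE -raddfB.
by congr (\pi_(gauss_manin F) _); exact: nablaB.
Qed.

Lemma G_dssB l : zmod_morphism (G_dss l).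
Proof. by elim: l => // p l IH x y; rewrite [LHS]/= G_dsB; exact: IH. Qed.

Lemma G_ds_uinv p w : G_ds p (G_uinv w) = G_uinv (@G_ds R n P F p w).
Proof.
rewrite -[w]reprK !(G_uinvE, G_dsE); congr (\pi_(gauss_manin F) _).
exact/val_inj.
Qed.

Lemma G_dss_uinv l w : G_dss l (G_uinv w) = G_uinv (G_dss l w).
Proof. by elim: l w => //= p l IH w; rewrite G_ds_uinv IH. Qed.

Lemma H_inclB : zmod_morphism (@H_incl R n P F).
Proof.
move=> x y; rewrite -[x]reprK -[y]reprK -raddfB !H_inclE -raddfB.
by congr (\pi_(gauss_manin F) _); exact: lps_inclB.
Qed.

(** ** Restriction to [s = 0] *)

Lemma laurent_restr (g : lps R Y) :
  gevrey_laurent (fun (e : mexp X) k => g (xs (xpart e) ezero) k).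
Proof.
by case: (lpsP g) => N gN; exists N; apply: (gevrey_pull (@edeg_restr n P) gN).
Qed.

Definition lps_restr (g : lps R Y) : lps R X := lps_mk (laurent_restr g).

Lemma lps_restrB : zmod_morphism lps_restr.
Proof. by move=> x y; apply/val_inj. Qed.

Lemma lps_restr_tw eta :
  lps_restr (lps_tw F eta) = lps_tw (cps_restr F) (fun i => lps_restr (eta i)).
Proof.
rewrite /lps_tw (morph_sum _ _ lps_restrB); apply: eq_bigr => i _.
rewrite lps_restrB; congr (_ - _); apply/val_inj/funext => a; apply/funext => j.
  exact: (congr1 (fun k => k a) (restr_cder i (lps_val (eta i) ^~ (j - 1)))).
rewrite [RHS](_ : _ = cmul (cder (inl i) (cps_val F \o @ext0 n P))
                           ((lps_val (eta i) ^~ j) \o @ext0 n P) a) //.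
by rewrite -restr_cder -restr_cmul.
Qed.

Variable f : cps R X.
Hypothesis Ff : cps_restr F = f.

Definition G_restr : gauss_manin F -> gauss_manin f :=
  qmap (lps_exact F) (lps_exact f) lps_restr.

Lemma G_restrE g : G_restr (\pi_(gauss_manin F) g) = \pi_(gauss_manin f) (lps_restr g).
Proof.
apply: qmapE; first exact: lps_restrB.
move=> _ /asboolP[eta ->]; apply/asboolP; eexists; rewrite -Ff; exact: lps_restr_tw.
Qed.

Lemma H_restr_piE g :
  H_restr f (\pi_(brieskorn F) g) = \pi_(brieskorn f) (gps_restr g).
Proof.
apply: qmapE; first exact: gps_restrB.
move=> _ /asboolP[eta ->]; apply/asboolP; eexists; rewrite -Ff; exact: gps_restr_tw.
Qed.

Lemma G_restrB : zmod_morphism G_restr.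
Proof.
move=> x y; rewrite -[x]reprK -[y]reprK -raddfB !G_restrE -raddfB.
by congr (\pi_(gauss_manin f) _); exact: lps_restrB.
Qed.

Lemma G_restr_uinv w : G_restr (G_uinv w) = G_uinv (G_restr w).
Proof.
rewrite -[w]reprK !(G_uinvE, G_restrE); congr (\pi_(gauss_manin f) _).
exact/val_inj.
Qed.

Lemma G_restr_incl v : G_restr (H_incl v) = H_incl (H_restr f v).
Proof.
rewrite -[v]reprK !(H_inclE, G_restrE, H_restr_piE).
by congr (\pi_(gauss_manin f) _); exact/val_inj.
Qed.

(** ** The leading Taylor coefficients *)

Definition content l : mexp P := foldr (fun p a => eadd a (eunit p)) ezero l.

Lemma edeg_content l : edeg (content l) = size l.
Proof.
elim: l => [|p l IH] /=; first by rewrite /edeg big1 // => p _; rewrite ffunE.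
by rewrite edeg_eadd IH edeg_eunit addn1.
Qed.

Lemma efact_eadd_eunit a p : efact (eadd a (eunit p)) = ((a p).+1 * efact a)%N.
Proof.
rewrite /efact (bigD1 p) //= [in RHS](bigD1 p) //= !ffunE eqxx addn1 factS mulnA.
by congr (_ * _)%N; apply: eq_bigr => q /negPf qp; rewrite !ffunE qp addn0.
Qed.

Lemma content_surj a : exists l, content l = a.
Proof.
elim: {a}(edeg a) {-2}a (erefl (edeg a)) => [|N IH] a aN.
  exists [::]; apply/ffunP => p; rewrite ffunE; apply/esym/eqP.
  by rewrite -leqn0 -aN leq_edeg.
have [/existsP[p ap]|] := boolP [exists p, (0 < a p)%N]; last first.
  rewrite negb_exists => /forallP a0; move: aN; rewrite /edeg big1 // => p _.
  by apply/eqP; rewrite -leqn0 leqNgt.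
have aE : eadd (esub a (eunit p)) (eunit p) = a.
  by apply/ffunP => q; rewrite !ffunE; case: eqP => [->|_]; rewrite ?subn0 ?addn0 ?subnK.
have [|l lE] := IH (esub a (eunit p)).
  by move: aN; rewrite -{1}aE edeg_eadd edeg_eunit addn1 => -[].
by exists (p :: l); rewrite /= lE aE.
Qed.

Lemma spart_eadd e p : spart (eadd e (eunit (inr p : Y))) = eadd (spart e) (eunit p).
Proof. by apply/ffunP => q; rewrite !ffunE (inj_eq inr_inj). Qed.

Lemma s_order_mul j h g : s_order j g -> s_order j (lmul h g).
Proof.
move=> gj e k ej; rewrite /lmul cmulE big_seq big1 // => b; rewrite mem_below => be.
rewrite gj ?mulr0 // (leq_ltn_trans _ ej) // /edeg.
by apply: leq_sum => p _; rewrite !ffunE leq_subr.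
Qed.

Lemma nablaE p (g : lps R Y) e k : nabla p g e k =
  (e (inr p)).+1%:R * g (eadd e (eunit (inr p : Y))) k -
  lmul (cder (inr p) F) g e (k + 1).
Proof. by rewrite -[k + 1]/(k - -1). Qed.

Lemma s_order_nabla j p (g : lps R Y) : s_order j.+1 g -> s_order j (nabla p g).
Proof.
move=> gj e k ej; rewrite nablaE (s_order_mul _ gj) ?(leq_trans ej) // subr0.
by rewrite gj ?mulr0 // spart_eadd edeg_eadd edeg_eunit addn1.
Qed.

(** Only the differentiations [d/ds_p] can lower the order, so on a series of
    order [size l] the connection acts at [s = 0] as these. *)
Lemma restr_nablas l (g : lps R Y) (e : mexp 'I_n.+1) k : s_order (size l) g ->
  nablas l g (xs e ezero) k = (efact (content l))%:R * g (xs e (content l)) k.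
Proof.
elim: l g => [|p l IH] g gl /=.
  by rewrite /efact big1 ?mul1r // => p _; rewrite ffunE.
rewrite IH; last exact: s_order_nabla.
rewrite nablaE (s_order_mul _ gl) ?subr0; last first.
  rewrite (_ : spart _ = content l) ?edeg_content //.
  by apply/ffunP => q; rewrite !ffunE.
rewrite efact_eadd_eunit mulnC natrM mulrA ffunE; congr (_ * g _ _).
by apply/ffunP => -[i|q]; rewrite !ffunE ?addn0 // (inj_eq inr_inj).
Qed.

(** ** Raising the order of a representative *)

Lemma gevrey_slice a (g : gps R Y) :
  gevrey (fun (e : mexp X) k => g (xs (xpart e) a) k).
Proof.
apply: (gevrey_reindex (P := predT) (c := edeg a) _ (gpsP g)) => e _.
by rewrite edeg_xs leq_add2r edeg_parts leq_addr.
Qed.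

Definition gps_slice a (g : gps R Y) : gps R X := gps_mk (gevrey_slice a g).

Lemma gevrey_ext (h : gps R X) : gevrey (fun e k =>
  if spart e == ezero then h (xs (xpart e) ezero) k else 0).
Proof.
apply: (gevrey_reindex (c := 0%N) _ (gpsP h)) => e _.
rewrite addn0 edeg_xs edeg_parts leq_add2l /edeg big1 // => -[].
Qed.

Definition gps_ext (h : gps R X) : gps R Y := gps_mk (gevrey_ext h).

Lemma gps_ext_restr h : gps_restr (gps_ext h) = h.
Proof.
apply/val_inj/funext => e; apply/funext => k; rewrite /= (_ : spart _ = ezero) ?eqxx.
  by congr (gps_val h _ _); apply/ffunP => -[i|[]]; rewrite !ffunE.
by apply/ffunP => p; rewrite !ffunE.
Qed.

Lemma sincl_mono a e : sincl (cps_mono R a) e = cmono (xs ezero a : mexp Y) e.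
Proof.
rewrite /= /cmono; case: eqP => [xe|xe]; last first.
  by case: eqP => // ee; case: xe; rewrite ee; apply/ffunP => i; rewrite !ffunE.
congr (_%:R); congr nat_of_bool; apply/eqP/eqP => [<-|->].
  by rewrite -xe xs_parts.
by apply/ffunP => p; rewrite !ffunE.
Qed.

Lemma gps_mul_mono a (g : gps R Y) e k : gps_mul (sincl (cps_mono R a)) g e k =
  if ele a (spart e) then g (xs (xpart e) (esub (spart e) a)) k else 0.
Proof.
rewrite [LHS](_ : _ = lmul (sincl (cps_mono R a)) g e k) //.
rewrite (_ : cps_val _ = cmono (xs ezero a)); last by apply/funext; exact: sincl_mono.
rewrite lmul_mono; have -> : ele (xs ezero a) e = ele a (spart e).
  apply/eleP/eleP => [H p|H [i|p]]; first by have := H (inr p); rewrite !ffunE.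
    by rewrite !ffunE.
  by have := H p; rewrite !ffunE.
case: ifP => // _; congr (g _ _); apply/ffunP => -[i|p]; rewrite !ffunE //.
by rewrite subn0.
Qed.

Lemma bval_surj k a : (edeg a <= k)%N -> exists b : bexp k, bval b = a.
Proof.
move=> ak; have lt p : (a p < k.+1)%N by rewrite ltnS (leq_trans (leq_edeg _ _)).
by exists [ffun p => Ordinal (lt p)]; apply/ffunP => p; rewrite !ffunE.
Qed.

(** Subtracting [s^a (ud - dF^) eta] for every [a] of degree [j] changes the
    slice of order [a] by [(ud - df^)] of the restriction of [eta], and no other
    slice of order at most [j]. *)
Lemma s_order_step j (g : gps R Y) : s_order j g ->
    (forall a, edeg a = j -> gps_slice a g \in gps_exact f) ->
  exists2 g' : gps R Y, \pi_(brieskorn F) g' = \pi_(brieskorn F) g & s_order j.+1 g'.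
Proof.
move=> gj Hex.
have /choice[eta Heta] : forall a, exists e : 'I_n.+1 -> gps R X,
    edeg a = j -> gps_slice a g = gps_tw f e.
  move=> a; have [ja|ja] := eqVneq (edeg a) j.
    by have /asboolP[e E] := Hex a ja; exists e.
  by exists (fun=> 0) => ja'; rewrite ja' eqxx in ja.
pose t a : gps R Y := gps_tw F (fun i => gps_ext (eta a i)).
exists (g - \sum_(b : bexp j | edeg (bval b) == j)
              gps_mul (sincl (cps_mono R (bval b))) (t (bval b))).
  rewrite raddfB raddf_sum big1 ?subr0 // => b _; apply/eqP.
  rewrite -[X in _ == X](raddf0 (\pi_(brieskorn F))) -Quotient.idealrBE subr0.
  apply/asboolP; exists (fun i => gps_mul (sincl (cps_mono R (bval b)))
                                     (gps_ext (eta (bval b) i))).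
  apply/val_inj; rewrite [RHS]val_gps_tw [LHS]/= val_gps_tw ftw_mul //.
  by move=> i; exact: (cder_sincl i (cps_mono R (bval b))).
move=> e k; rewrite ltnS => ej.
rewrite [LHS](_ : _ = g e k - (\sum_(b : bexp j | edeg (bval b) == j)
              gps_mul (sincl (cps_mono R (bval b))) (t (bval b))) e k) // gps_sumE.
have H b : edeg b = j ->
    gps_mul (sincl (cps_mono R b)) (t b) e k = if spart e == b then g e k else 0.
  move=> bj; rewrite gps_mul_mono; case: ifP => be; last first.
    by case: eqP be => // ->; rewrite (_ : ele b b) //; apply/eleP.
  have eb : spart e = b.
    apply: ele_esub_edeg => //; apply/eqP; rewrite eqn_leq bj ej /=.
    by rewrite -bj -(ele_edeg be) leq_addr.
  rewrite eb eqxx (_ : esub b b = ezero); last first.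
    by apply/ffunP => p; rewrite !ffunE subnn.
  rewrite -[RHS](_ : gps_slice b g (xs (xpart e) ezero) k = _); last first.
    rewrite /=; congr (g _ _); rewrite -eb -[RHS]xs_parts; congr (xs _ _).
    by apply/ffunP => i; rewrite !ffunE.
  rewrite Heta // -[t b _ _](_ : gps_restr (t b) (xs (xpart e) ezero) k = _); last first.
    by rewrite /=; congr (gps_val _ _ _); apply/ffunP => -[i|p]; rewrite !ffunE.
  rewrite gps_restr_tw Ff; congr (gps_tw _ _ _ _); apply/funext => i.
  exact: gps_ext_restr.
rewrite (eq_bigr (fun b : bexp j => if spart e == bval b then g e k else 0)); last first.
  by move=> b /eqP; exact: H.
have [lt_ej|le_je] := ltnP (edeg (spart e)) j.
  by rewrite gj // sub0r big1 ?oppr0 // => b _; rewrite if_same.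
have eE : edeg (spart e) = j by apply/eqP; rewrite eqn_leq ej.
have [b bE] := bval_surj ej.
rewrite (bigD1 b) /= ?bE ?eE // eqxx big1 ?addr0 ?subrr // => c /andP[_ cb].
by case: eqP => // ec; case/eqP: cb; apply: bval_inj; rewrite bE.
Qed.

(** ** Division by the parameters *)

(** A monomial of positive order in [s] is divided by one chosen parameter, so
    that a series is the sum of its quotients times the parameters. *)
Definition first_param (a : mexp P) : option P := [pick p | (0 < a p)%N].

Lemma gevrey_quot p (g : gps R Y) : gevrey (fun e k =>
  if first_param (eadd (spart e) (eunit p)) == Some p
  then g (eadd e (eunit (inr p : Y))) k else 0).
Proof.
apply: (gevrey_reindex (c := 1%N) _ (gpsP g)) => e _.
by rewrite edeg_eadd edeg_eunit.
Qed.

Definition gps_quot p (g : gps R Y) : gps R Y := gps_mk (gevrey_quot p g).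

Lemma s_order_mpow j (g : gps R Y) : s_order j g -> H_mpow j (\pi_(brieskorn F) g).
Proof.
elim: j g => [//|j IH] g gj.
exists #|P|, (fun i => cps_mono R (eunit (enum_val i))),
  (fun i => \pi_(brieskorn F) (gps_quot (enum_val i) g)); split.
- move=> i; rewrite /= /cmono; case: eqP => // /ffunP /(_ (enum_val i)).
  by rewrite !ffunE eqxx.
- move=> i; apply: IH => e k ej; rewrite /=; case: ifP => // _.
  by rewrite gj // spart_eadd edeg_eadd edeg_eunit addn1.
rewrite (eq_bigr (fun i => \pi_(brieskorn F)
  (gps_mul (sincl (cps_mono R (eunit (enum_val i)))) (gps_quot (enum_val i) g)))); last first.
  by move=> i _; rewrite H_smulE.
rewrite -raddf_sum; congr (\pi_(brieskorn F) _).
apply/val_inj/funext => e; apply/funext => k; rewrite [RHS]gps_sumE.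
rewrite -(reindex (fun i : 'I_#|P| => enum_val i) (P := xpredT) (F := fun p =>
  gps_mul (sincl (cps_mono R (eunit p))) (gps_quot p g) e k)) /=; last first.
  exact/onW_bij/enum_val_bij.
have quotE p : gps_mul (sincl (cps_mono R (eunit p))) (gps_quot p g) e k =
    if first_param (spart e) == Some p then g e k else 0.
  rewrite gps_mul_mono; have -> : ele (eunit p) (spart e) = (0 < spart e p)%N.
    by rewrite -sgl1 ele_sgl.
  case: ltnP => [ep|]; last first.
    rewrite leqn0 => /eqP ep; case: eqP => //; rewrite /first_param.
    by case: pickP => [q qe [qp]|//]; rewrite qp ep in qe.
  rewrite /= (_ : eadd (spart _) _ = spart e); last first.
    apply/ffunP => q; have := ep; rewrite !ffunE; case: eqP => [->|_] ?.
      by rewrite subnK.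
    by rewrite subn0 addn0.
  case: ifP => // _; congr (g _ _); apply/ffunP => -[i|q]; rewrite !ffunE.
    by rewrite addn0.
  have := ep; rewrite ffunE (inj_eq inr_inj); case: eqP => [->|_] ?.
    by rewrite subnK.
  by rewrite subn0 addn0.
rewrite (eq_bigr _ (fun p _ => quotE p)) /first_param; case: pickP => [p _|e0].
  rewrite (bigD1 p) //= eqxx big1 ?addr0 // => q /negPf qp.
  by rewrite (inj_eq (@Some_inj _)) eq_sym qp.
rewrite big1 // gj // /edeg big1 // => p _; apply/eqP; rewrite -leqn0 leqNgt.
by rewrite e0.
Qed.

End Filtration.

(** * Taylor coefficients of monomial classes *)

Section MonomialTaylor.
Context {R : realType} {n : nat}.
Variable m : 'I_n.+1 -> nat.
Hypothesis hm : forall i, (2 <= m i)%N.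
Local Notation C := R[i].
Local Notation P := (Gam m).
Local Notation Y := (vars n P).
Local Notation X := (vars n void).
Local Notation F := (pham_F m R).
Local Notation f := (pham_f m R).
Implicit Types (nu mu : P) (a b : mexp P) (p : mexp 'I_n.+1) (l : seq P).

Definition pexp a : mexp 'I_n.+1 := [ffun i => pa a i].

Lemma pa_eadd a b i : pa (eadd a b) i = (pa a i + pa b i)%N.
Proof. by rewrite /pa -big_split; apply: eq_bigr => nu _; rewrite ffunE mulnDr. Qed.

Lemma pa_eunit nu i : pa (eunit nu) i = gexp nu i.
Proof.
rewrite /pa (bigD1 nu) //= big1 ?addn0; last first.
  by move=> mu /negPf mn; rewrite ffunE mn muln0.
by rewrite !ffunE eqxx muln1.
Qed.

Lemma eadd_esub b a : ele b a -> eadd b (esub a b) = a.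
Proof. by move=> /eleP ba; apply/ffunP => nu; rewrite !ffunE subnKC. Qed.

Lemma cder_pham_s nu e : cder (inr nu) F e = cmono (xs (gexp nu) ezero) e.
Proof.
have E mu : (eadd e (eunit (inr nu : Y)) == xs (gexp mu) (eunit mu)) =
    (nu == mu) && (e == xs (gexp nu) ezero).
  apply/eqP/andP => [/ffunP H|[/eqP <- /eqP ->]]; last first.
    by apply/ffunP => -[i|q]; rewrite !ffunE ?addn0.
  have nm : nu = mu.
    have := H (inr nu); rewrite !ffunE eqxx; case: eqP => // _.
    by rewrite addn1.
  split; first by rewrite nm.
  rewrite -{mu}nm in H; apply/eqP/ffunP => -[i|q].
    by have := H (inl i); rewrite !ffunE addn0.
  by have := H (inr q); rewrite !ffunE (inj_eq inr_inj) => /eqP;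
    rewrite -[X in _ == X]add0n eqn_add2r => /eqP.
rewrite /cder [F _](_ : _ = pham m R P (eadd e (eunit (inr nu : Y))) +
  (\sum_(mu : P) cps_mono R (xs (gexp mu) (eunit mu))) (eadd e (eunit (inr nu : Y)))) //.
rewrite !cps_sumE big1 ?add0r; last first.
  move=> i _; rewrite [LHS]/= /cmono; case: eqP => // /ffunP /(_ (inr nu)).
  by rewrite !ffunE eqxx addn1.
rewrite (eq_bigr (fun mu => ((nu == mu) && (e == xs (gexp nu) ezero))%:R)); last first.
  by move=> mu _; rewrite -E.
rewrite (bigD1 nu) //= eqxx big1 ?addr0 /=; last first.
  by move=> mu /negPf mn; rewrite eq_sym mn.
rewrite /cmono; case: eqP => [->|_]; last by rewrite mulr0.
by rewrite !ffunE mulr1.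
Qed.

Lemma nablaZ nu (c : C) (g : lps R Y) : nabla F nu (c *: g) = c *: nabla F nu g.
Proof.
apply/val_inj/funext => e; apply/funext => k.
rewrite [LHS]nablaE [RHS](_ : _ = c * nabla F nu g e k) // nablaE mulrBr.
have cE (a : mexp Y) j : (c *: g) a j = c * g a j by [].
rewrite cE mulrCA; congr (_ - _); rewrite /lmul /cmul mulr_sumr.
by apply: eq_bigr => b _; rewrite cE mulrCA.
Qed.

Lemma nablasZ l (c : C) (g : lps R Y) : nablas F l (c *: g) = c *: nablas F l g.
Proof. by elim: l g => // nu l IH g; rewrite [LHS]/= nablaZ; exact: IH. Qed.

Lemma nabla_mono nu p b j :
  nabla F nu (lps_mono (xs p b) j) =
  (b nu)%:R *: lps_mono (xs p (esub b (eunit nu))) j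
  - lps_mono (xs (eadd p (gexp nu)) b) (j - 1) :> lps R Y.
Proof.
apply/val_inj/funext => e; apply/funext => k; rewrite [LHS]nablaE.
rewrite [RHS](_ : _ = (b nu)%:R * lps_mono (xs p (esub b (eunit nu))) j e k -
  lps_mono (xs (eadd p (gexp nu)) b) (j - 1) e k) //.
rewrite (_ : cder _ _ = cmono (xs (gexp nu) ezero)); last first.
  by apply/funext => a; exact: cder_pham_s.
rewrite lmul_mono !lps_monoE; congr (_ - _).
  case: (eqVneq (eadd e (eunit (inr nu : Y))) (xs p b)) => [/ffunP H|ne].
    have Hnu : (e (inr nu)).+1 = b nu.
      by have := H (inr nu); rewrite !ffunE eqxx addn1.
    rewrite Hnu (_ : e == _) //; apply/eqP/ffunP => -[i|mu].
      by have := H (inl i); rewrite !ffunE addn0.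
    have := H (inr mu); rewrite !ffunE (inj_eq inr_inj); case: eqP => _ <-.
      by rewrite addn1 subn1.
    by rewrite addn0 subn0.
  rewrite mulr0; case: eqP => [eE|_]; last by rewrite mulr0.
  case: (posnP (b nu)) => [->|bnu]; first by rewrite mul0r.
  case/eqP: ne; apply/ffunP => -[i|mu]; rewrite eE !ffunE ?addn0 //.
  rewrite (inj_eq inr_inj); case: eqP => [->|_]; last by rewrite subn0 addn0.
  by rewrite subn1 addn1 prednK.
have -> : (k == j - 1) = (k + 1 == j) by rewrite eq_sym subr_eq eq_sym.
case: ifP => [/eleP le_e|nle]; last first.
  case: eqP => [eE|_]; last by rewrite andFb.
  case/negP: nle; apply/eleP => -[i|mu]; rewrite eE !ffunE //.
  by rewrite leq_addl.
congr ((_ && _)%:R); apply/eqP/eqP => [/ffunP H|->].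
  apply/ffunP => -[i|mu].
    have := H (inl i); have := le_e (inl i); rewrite !ffunE => le_i <-.
    by rewrite subnK.
  by have := H (inr mu); rewrite !ffunE subn0.
by apply/ffunP => -[i|mu]; rewrite !ffunE ?addnK ?subn0.
Qed.

Definition ffacts a b : nat := (\prod_nu (a nu) ^_ (b nu))%N.

Lemma ffactSD k d : (k.+1 ^_ d.+1 = d.+1 * k ^_ d + k ^_ d.+1)%N.
Proof.
rewrite ffactSS ffactnSr [X in (_ + X)%N]mulnC -mulnDl.
case: (leqP d k) => [le_dk|lt_kd]; first by rewrite addSn subnKC.
by rewrite ffact_small // !muln0.
Qed.

Lemma ffacts_fact a b : ele b a -> (ffacts a b * efact (esub a b) = efact a)%N.
Proof.
move=> /eleP ba; rewrite /ffacts /efact -big_split; apply: eq_bigr => nu _ /=.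
by rewrite ffunE ffact_fact.
Qed.

Lemma ffacts_notle a b : ~~ ele b a -> ffacts a b = 0%N.
Proof.
rewrite negb_forall; case/existsP => nu; rewrite -ltnNge => lt_ab.
by rewrite /ffacts (bigD1 nu) //= ffact_small.
Qed.

(** With [d = a - b], [exp_term d p j] is [d!] times the coefficient of [s^a] in
    [exp (- \sum_nu s_nu x^nu / u) x^p s^b u^j]. *)
Definition exp_term (d : mexp P) p j : lps R X :=
  (-1) ^+ edeg d *: lps_mono (xexp (eadd p (pexp d))) (j - (edeg d)%:Z).

Lemma exp_termS d nu p j :
  exp_term (eadd d (eunit nu)) p j = - exp_term d (eadd p (gexp nu)) (j - 1).
Proof.
rewrite /exp_term edeg_eadd edeg_eunit addn1 exprS mulN1r scaleNr; congr (- (_ *: _)).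
congr (lps_mono (xexp _) _); last by lia.
by apply/ffunP => i; rewrite !ffunE pa_eadd pa_eunit !ffunE; lia.
Qed.

(** The derivative at [s = 0] of order [a = content l] is [a!] times the
    coefficient of [s^a], and [ffacts a b] is [a!/(a - b)!], or zero unless
    [b <= a]. *)
Lemma restr_nablas_mono l p b j :
  lps_restr (nablas F l (lps_mono (xs p b) j)) =
  (ffacts (content l) b)%:R *: exp_term (esub (content l) b) p j.
Proof.
elim: l p b j => [|nu l IH] p b j /=.
  have -> : esub (ezero : mexp P) b = ezero by apply/ffunP => nu; rewrite !ffunE sub0n.
  have e0 : edeg (ezero : mexp P) = 0%N by rewrite /edeg big1 // => nu _; rewrite ffunE.
  rewrite /exp_term e0 expr0 scale1r subr0 (_ : eadd p _ = p); last first.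
    apply/ffunP => i; rewrite !ffunE /pa big1 ?addn0 // => nu _.
    by rewrite ffunE muln0.
  apply/val_inj/funext => e; apply/funext => k.
  rewrite [LHS](_ : _ = lps_mono (xs p b) j (xs (xpart e) ezero) k) //.
  rewrite [RHS](_ : _ = (ffacts ezero b)%:R * lps_mono (xexp p) j e k) // !lps_monoE.
  have -> : (xs (xpart e) ezero == xs p b) = (b == ezero) && (e == xexp p).
    apply/eqP/andP => [/ffunP H|[/eqP -> /eqP ->]]; last first.
      by apply/ffunP => -[i|mu]; rewrite !ffunE.
    split; apply/eqP/ffunP; first by move=> nu; have := H (inr nu); rewrite !ffunE.
    by case=> [i|[]]; have := H (inl i); rewrite !ffunE.
  have [->|b0] := eqVneq b ezero.
    by rewrite /ffacts big1 ?mul1r // => nu _; rewrite ffunE.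
  rewrite ffacts_notle ?mul0r //; apply: contra b0 => /eleP b0.
  by apply/eqP/ffunP => nu; have := b0 nu; rewrite !ffunE leqn0 => /eqP.
rewrite nabla_mono nablasB nablasZ lps_restrB.
rewrite [lps_restr (_ *: _)](_ : _ =
  (b nu)%:R *: lps_restr (nablas F l (lps_mono (xs p (esub b (eunit nu))) j))); last first.
  exact/val_inj.
rewrite !IH scalerA; set c := content l.
pose Q := (\prod_(mu | mu != nu) (c mu) ^_ (b mu))%N.
have fE : ffacts c b = (c nu ^_ b nu * Q)%N by rewrite /ffacts (bigD1 nu).
have fE' : ffacts (eadd c (eunit nu)) b = ((c nu).+1 ^_ b nu * Q)%N.
  rewrite /ffacts (bigD1 nu) //= !ffunE eqxx addn1; congr (_ * _)%N.
  by apply: eq_bigr => mu /negPf mn; rewrite !ffunE mn addn0.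
have fE'' : ffacts c (esub b (eunit nu)) = (c nu ^_ (b nu).-1 * Q)%N.
  rewrite /ffacts (bigD1 nu) //= !ffunE eqxx subn1; congr (_ * _)%N.
  by apply: eq_bigr => mu /negPf mn; rewrite !ffunE mn subn0.
rewrite fE fE' fE''.
have second : (c nu ^_ b nu * Q)%N%:R *: exp_term (esub c b) (eadd p (gexp nu)) (j - 1) =
    - (c nu ^_ b nu * Q)%N%:R *: exp_term (esub (eadd c (eunit nu)) b) p j.
  have [le_bc|lt_cb] := leqP (b nu) (c nu); last first.
    by rewrite ffact_small // mul0n oppr0 !scale0r.
  rewrite (_ : esub (eadd _ _) _ = eadd (esub c b) (eunit nu)); last first.
    apply/ffunP => mu; rewrite !ffunE; case: eqP => [->|_]; last by rewrite !addn0.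
    by rewrite addnBAC.
  by rewrite exp_termS scalerN scaleNr opprK.
rewrite second scaleNr opprK; case bE: (b nu) => [|d].
  by rewrite mul0r scale0r add0r.
rewrite (_ : esub (eadd c _) b = esub c (esub b (eunit nu))); last first.
  apply/ffunP => mu; rewrite !ffunE; case: eqP => [->|_].
    by rewrite bE addn1 subn1 subSS.
  by rewrite addn0 subn0.
by rewrite -scalerDl -natrM -natrD ffactSD /= mulnDl mulnA.
Qed.

End MonomialTaylor.

(** * The coefficients *)

Section Coefficients.
Context {R : realType} {n : nat}.
Variable m : 'I_n.+1 -> nat.
Local Notation C := R[i].
Local Notation P := (Gam m).
Implicit Types (a b : mexp P) (c : mexp P -> C) (k d : nat).

Definition coef_term c a b : C :=
  (-1) ^+ edeg (esub a b) * (c b / (efact (esub a b))%:R) *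
    \prod_i \prod_(1 <= l < (qab a b i).+1)
      (((ra b i + pa (esub a b) i)%N%:R - (l * m i)%N%:R + 1) / (m i)%:R).

Lemma edeg0 (Y : finType) : edeg (ezero : mexp Y) = 0%N.
Proof. by rewrite /edeg big1 // => y _; rewrite ffunE. Qed.

Lemma edeg_eq0 (Y : finType) (a : mexp Y) : edeg a = 0%N -> a = ezero.
Proof.
by move=> a0; apply/ffunP => y; apply/eqP; rewrite ffunE -leqn0 -a0 leq_edeg.
Qed.

Lemma elt_edeg b a : elt b a -> (edeg b < edeg a)%N.
Proof.
move=> /andP[ba ne]; rewrite ltn_neqAle -(ele_edeg ba) leq_addr andbT.
rewrite ele_edeg //; apply: contra_neq ne => E.
by apply/esym/(ele_esub_edeg ba).
Qed.

(** [d] bounds the degree of [a]. *)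
Fixpoint coef_fuel k d a : C :=
  if a == ezero then 1 else
  if d is d'.+1 then
    - \sum_(b : bexp k | in_A' k (bval b) && elt (bval b) a)
        coef_term (coef_fuel k d') a (bval b)
  else 0.

Lemma coef_fuel_stable k d d' a : (edeg a <= d)%N -> (edeg a <= d')%N ->
  coef_fuel k d a = coef_fuel k d' a.
Proof.
elim: d d' a => [|d IH] [|d'] a ad ad' //=.
- by rewrite (@edeg_eq0 _ a) ?eqxx //; apply/eqP; rewrite -leqn0.
- by rewrite (@edeg_eq0 _ a) ?eqxx //; apply/eqP; rewrite -leqn0.
case: ifP => // _; congr (- _); apply: eq_bigr => b /andP[_ ba].
rewrite /coef_term (IH d') //; rewrite -ltnS.
  exact: leq_trans (elt_edeg ba) ad.
exact: leq_trans (elt_edeg ba) ad'.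
Qed.

Lemma coef_rec_exists k : exists c, coef_rec k c.
Proof.
exists (fun a => coef_fuel k (edeg a) a); split; first by rewrite edeg0 /= eqxx.
move=> a _ a0; case E: (edeg a) => [|d]; first by rewrite (edeg_eq0 E) eqxx in a0.
rewrite /= (negPf a0); congr (- _); apply: eq_bigr => b /andP[_ ba].
rewrite /coef_term (@coef_fuel_stable k d (edeg (bval b))) //.
by rewrite -ltnS -E elt_edeg.
Qed.

Lemma coef_rec_uniq k c c' : coef_rec k c -> coef_rec k c' ->
  forall a, in_A' k a -> c' a = c a.
Proof.
move=> [c0 crec] [c'0 c'rec] a.
elim: {a}(edeg a).+1 {-2}a (ltnSn (edeg a)) => // d IH a ad aA.
have [->|a0] := eqVneq a ezero; first by rewrite c0.
rewrite crec // c'rec //; congr (- _); apply: eq_bigr => b /andP[bA ba].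
by rewrite IH // -ltnS (leq_trans _ ad) // ltnS elt_edeg.
Qed.

End Coefficients.

(** * Taylor coefficients of the candidate and of the primitive form *)

Section Comparison.
Context {R : realType} {n : nat}.
Variable m : 'I_n.+1 -> nat.
Hypothesis hm : forall i, (2 <= m i)%N.
Local Notation C := R[i].
Local Notation P := (Gam m).
Local Notation Y := (vars n P).
Local Notation F := (pham_F m R).
Local Notation f := (pham_f m R).
Local Notation piG := (\pi_(gauss_manin f)).
Local Notation Grestr := (@G_restr R n P F f).
Local Notation restrF := (restr_pham R m).
Implicit Types (a b : mexp P) (c : mexp P -> C) (l : seq P).

Let m_gt0 i : (0 < m i)%N. Proof. exact: leq_trans (hm i). Qed.

Definition candidate k (c : mexp P -> C) : brieskorn F :=
  \sum_(a : bexp k | in_A' k (bval a))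
     H_scale (c (bval a)) (H_upow `|ea (bval a)|%N
        (H_class F (cps_mono R (xs (ra (bval a)) (bval a))))).

Lemma H_incl_candidate k c : H_incl (candidate k c) =
  \pi_(gauss_manin F) (\sum_(b : bexp k | in_A' k (bval b))
     c (bval b) *: lps_mono (xs (ra (bval b)) (bval b)) (ea (bval b))).
Proof.
pose g (b : bexp k) : gps R Y := c (bval b) *: iter `|ea (bval b)|%N (@gps_u R Y)
  (gps_incl (cps_mono R (xs (ra (bval b)) (bval b)))).
have -> : candidate k c = \pi_(brieskorn F) (\sum_(b : bexp k | in_A' k (bval b)) g b).
  rewrite raddf_sum; apply: eq_bigr => b _; rewrite -[RHS]H_scaleE; congr H_scale.
  by elim: `|_|%N => //= N ->; rewrite H_uE.
rewrite H_inclE; congr (\pi_(gauss_manin F) _); apply/val_inj/funext => e.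
apply/funext => j; rewrite [RHS]lps_sumE.
rewrite [LHS](_ : _ = (\sum_(b : bexp k | in_A' k (bval b)) g b) e j) // gps_sumE.
apply: eq_bigr => b /and3P[_ eb _]; pose M : gps R Y := gps_incl (cps_mono R (xs (ra (bval b)) (bval b))).
rewrite [RHS](_ : _ = c (bval b) *
  lps_mono (xs (ra (bval b)) (bval b)) (ea (bval b)) e j) // lps_monoE.
rewrite [LHS](_ : _ = c (bval b) * iter `|ea (bval b)|%N (@gps_u R Y) M e j) //.
congr (_ * _); rewrite -[in RHS](gez0_abs eb).
have iterE N i : iter N (@gps_u R Y) M e i = M e (i - N%:Z).
  elim: N i => [|N IH] i; first by rewrite subr0.
  by rewrite [LHS](_ : _ = iter N (@gps_u R Y) M e (i - 1)) // IH; congr (M e _); lia.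
rewrite iterE /M /= /cincl /cmono subr_eq0.
by case: (j == _); rewrite ?andbT ?andbF.
Qed.

(** By [restr_nablas_mono] and [mono_reduce]. The powers of [u] add up to [e_a]
    because [p(a) = p(b) + p(a - b)], so that [q(a) = q(b) + q(a, b)]. *)
Lemma restr_candidate_term l b (c : C) : let a := content l in
  piG (lps_restr (nablas F l (c *: lps_mono (xs (ra b) b) (ea b)))) =
  piG (((efact a)%:R * (if ele b a then coef_term (fun=> c) a b else 0)) *:
         lps_mono (xexp (ra a)) (ea a)).
Proof.
move=> a; rewrite nablasZ.
rewrite [lps_restr _](_ : _ = c *: lps_restr (nablas F l (lps_mono (xs (ra b) b) (ea b))));
  last exact/val_inj.
rewrite restr_nablas_mono -/a /exp_term !scalerA.
case: ifP => [ba|/negbT nba]; last first.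
  by rewrite ffacts_notle // mulr0 mul0r mulr0 !scale0r.
set d := esub a b; set q := eadd (ra b) (pexp d).
have paE i : pa a i = (pa b i + pa d i)%N by rewrite -pa_eadd eadd_esub.
have qE i : q i = (ra b i + pa d i)%N by rewrite !ffunE.
rewrite (piG_scale hm _ (mono_reduce hm q _)) scalerA.
congr (piG (_ *: lps_mono (xexp _) _)).
- rewrite -(ffacts_fact ba) natrM /coef_term -/d.
  have fd0 : (efact d)%:R != 0 :> C.
    by rewrite pnatr_eq0 -lt0n /efact prodn_gt0 // => nu; rewrite fact_gt0.
  rewrite (_ : mono_coef m q = \prod_i \prod_(1 <= l < (qab a b i).+1)
      (((ra b i + pa d i)%N%:R - (l * m i)%N%:R + 1) / (m i)%:R)).
    have mulE (x s y z K : C) : y != 0 -> z * x * s * K = x * y * (s * (z / y) * K).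
      by move=> y0; field.
    exact: mulE.
  by apply: eq_bigr => i _; rewrite qE.
- by apply/ffunP => i; rewrite ffunE qE !ffunE modnDml -paE.
have qaE : (\sum_i qa a i = \sum_i qa b i + \sum_i q i %/ m i)%N.
  rewrite -big_split; apply: eq_bigr => i _ /=.
  by rewrite qE /qa paE ffunE {1}(divn_eq (pa b i) (m i)) -addnA divnMDl.
by rewrite /ea qaE -(ele_edeg ba) -/d; lia.
Qed.

Lemma restr_candidate k c l : let a := content l in
  Grestr (G_dss l (H_incl (candidate k c))) =
  piG (((efact a)%:R * \sum_(b : bexp k | in_A' k (bval b) && ele (bval b) a)
          coef_term c a (bval b)) *: lps_mono (xexp (ra a)) (ea a)).
Proof.
move=> a; rewrite H_incl_candidate G_dssE (G_restrE restrF).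
rewrite -big_filter (morph_sum _ _ (nablasB F l)) (morph_sum _ _ (@lps_restrB R n P)).
rewrite raddf_sum big_filter.
rewrite (eq_bigr _ (fun (b : bexp k) _ => restr_candidate_term l (bval b) (c (bval b)))) -/a.
rewrite -raddf_sum -scaler_suml -mulr_sumr; congr (piG ((_ * _) *: _)).
by rewrite [RHS]big_mkcondr.
Qed.

Lemma coef_termxx c a : coef_term c a a = c a.
Proof.
have aa : esub a a = ezero by apply/ffunP => nu; rewrite !ffunE subnn.
have pa0 i : pa (ezero : mexp P) i = 0%N.
  by rewrite /pa big1 // => nu _; rewrite ffunE muln0.
rewrite /coef_term aa edeg0 expr0 mul1r [X in _ * X]big1 ?mulr1; last first.
  move=> i _; rewrite /qab aa pa0 addn0 ffunE divn_small ?ltn_pmod //.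
  by rewrite big_nil.
by rewrite /efact big1 ?divr1 // => nu _; rewrite ffunE.
Qed.

Lemma ra0 : ra (ezero : mexp P) = ezero.
Proof.
by apply/ffunP => i; rewrite !ffunE /pa big1 ?mod0n // => nu _; rewrite ffunE muln0.
Qed.

Lemma ea0 : ea (ezero : mexp P) = 0.
Proof.
rewrite /ea edeg0 big1 // => i _.
by rewrite /qa /pa big1 ?div0n // => nu _; rewrite ffunE muln0.
Qed.

Lemma in_A'0 k : in_A' k (ezero : mexp P).
Proof.
rewrite /in_A' edeg0 ea0 ra0 /=; apply/forallP => i.
by rewrite ffunE.
Qed.

(** The recursion for [c a], with the term of [b = a] moved to the other side. *)
Lemma coef_sum k c a : coef_rec k c -> in_A' k a ->
  \sum_(b : bexp k | in_A' k (bval b) && ele (bval b) a) coef_term c a (bval b)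
  = (a == ezero)%:R.
Proof.
move=> [c0 crec] aA; have [ak _ _] := and3P aA.
have [b bE] := bval_surj ak.
have aa : ele a a by apply/eleP.
rewrite (bigD1 b) /= ?bE ?aA ?aa // coef_termxx.
rewrite (eq_bigl (fun b : bexp k => in_A' k (bval b) && elt (bval b) a)); last first.
  move=> b'; rewrite /elt andbA; congr (_ && _); congr negb.
  by apply/eqP/eqP => [->|E]; rewrite ?bE //; apply: bval_inj; rewrite bE.
have [->|a0] := eqVneq a ezero; last first.
  by rewrite crec //; apply/eqP; rewrite addrC subr_eq0; apply/eqP/eq_bigr.
rewrite c0 big1 ?addr0 // => b' /andP[_ /elt_edeg].
by rewrite edeg0.
Qed.

(** If [a] is not in [A'_k], then [e_a < 0], or some [r(a)_i] equals [m_i - 1]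
    and [x^(r(a))] is exact. *)
Lemma candidate_low k c l : coef_rec k c -> (size l <= k)%N -> l != [::] ->
  low (-1) (Grestr (G_dss l (H_incl (candidate k c)))).
Proof.
move=> crec lk l0; rewrite restr_candidate; set a := content l.
have a0 : a != ezero.
  by apply: contra l0 => /eqP a0; rewrite -size_eq0 -edeg_content -/a a0 edeg0.
have [aA|] := boolP (in_A' k a).
  by rewrite coef_sum // (negPf a0) mulr0 scale0r raddf0; exact: low0.
have ak : (edeg a <= k)%N by rewrite edeg_content.
have [raG|] := boolP (in_Gam m (ra a)).
  rewrite /in_A' ak raG andbT /= -ltNge => ea_lt.
  apply: low_mono; first by lia.
  by rewrite (_ : xpart _ = ra a) //; apply/ffunP => i; rewrite !ffunE.
rewrite negb_forall; case/existsP => i; rewrite -ltnNge => ri _.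
have mono0 : piG (lps_mono (xexp (ra a)) (ea a)) = piG 0.
  rewrite raddf0; apply: (mono_boundary hm (i := i)).
  rewrite [LHS]ffunE [LHS]/= ffunE; move: ri; rewrite ffunE.
  by have := ltn_pmod (pa a i) (m_gt0 i); have := hm i; lia.
by rewrite (piG_scale hm _ mono0) scaler0 raddf0; exact: low0.
Qed.

Lemma restr_candidate0 k c : coef_rec k c ->
  Grestr (H_incl (candidate k c)) = piG (lps_mono (xexp ezero) 0).
Proof.
move=> crec; have /= := restr_candidate k c [::]; rewrite /G_dss /= => ->.
rewrite coef_sum // ?in_A'0 // eqxx mulr1 ra0 ea0.
by rewrite /efact big1 ?scale1r // => nu _; rewrite ffunE.
Qed.

(** [I_S[u^-1]] *)
Inductive opposite (sigmaS : jacobian F -> brieskorn F) : gauss_manin F -> Prop :=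
| opposite_incl v : range sigmaS v -> opposite sigmaS (H_incl v)
| opposite_add w w' : opposite sigmaS w -> opposite sigmaS w' -> opposite sigmaS (w + w')
| opposite_uinv w : opposite sigmaS w -> opposite sigmaS (G_uinv w).

Lemma opposite_ds sigma0 sigmaS nu w : good_extension sigma0 sigmaS ->
  opposite sigmaS w -> opposite sigmaS (G_ds nu w).
Proof.
move=> [_ _ _ _ dsI]; elim=> {w} [v vI|w w' _ IH _ IH'|w _ IH].
- have [v1 [v2 [v1I v2I ->]]] := dsI nu v vI.
  by apply: opposite_add; [|apply: opposite_uinv]; exact: opposite_incl.
- by rewrite (morphD (@G_dsB _ _ _ _ _)); exact: opposite_add.
- by rewrite G_ds_uinv; exact: opposite_uinv.
Qed.

Lemma opposite_low sigma0 sigmaS w :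
    canonical_section sigma0 -> good_extension sigma0 sigmaS ->
  opposite sigmaS w -> low 0 (Grestr w).
Proof.
move=> canon [_ _ restrI _ _]; elim=> {w} [_ [v _ <-]|w w' _ IH _ IH'|w _ IH].
- rewrite (G_restr_incl restrF) restrI; apply: (low_section hm canon).
  by exists (Om_restr f v).
- by rewrite (morphD (G_restrB restrF)); exact: lowD.
- by rewrite (G_restr_uinv restrF); apply: (low_le _ (low_uinv IH)).
Qed.

(** The first derivative of a horizontal section is in [u^-1 I_S], and the
    further ones stay in [u^-1 I_S[u^-1]]. *)
Lemma primitive_low (zeta : brieskorn F) l : primitive_form zeta -> l != [::] ->
  low (-1) (Grestr (G_dss l (H_incl zeta))).
Proof.
move=> [sigma0 [sigmaS [sigmaN [canon ext [_ _ _ horiz] ->]]]]; case: l => // nu l _.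
set w := Om_class _ _; have [v vI /= ->] := horiz nu w.
rewrite G_dss_uinv (G_restr_uinv restrF) -[-1]add0r; apply: low_uinv.
apply: (opposite_low canon ext).
elim: l (H_incl v) (opposite_incl vI) => //= mu l IH x xI.
by apply: IH; exact: (opposite_ds _ ext).
Qed.

Lemma restr_primitive0 (zeta : brieskorn F) : primitive_form zeta ->
  Grestr (H_incl zeta) = piG (lps_mono (xexp ezero) 0).
Proof.
move=> [sigma0 [sigmaS [sigmaN [canon _ [_ restrN _ _] ->]]]].
rewrite (G_restr_incl restrF) restrN (canonical_section1 hm canon) H_inclE.
congr (piG _); apply/val_inj/funext => e; apply/funext => j.
rewrite [RHS]lps_monoE /= /cincl /cmono (_ : xexp ezero = ezero); last first.
  by apply/ffunP => -[i|[]]; rewrite !ffunE.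
by case: (j == 0); rewrite ?andbT ?andbF.
Qed.

End Comparison.

Theorem mainTheorem3 (R : realType) (n : nat) (m : 'I_n.+1 -> nat)
    (hm : forall i, (2 <= m i)%N)
    (zeta : brieskorn (pham_F m R)) (hzeta : primitive_form zeta)
    (k : nat) (hk : (0 < k)%N) :
  exists c : mexp (Gam m) -> R[i],
    [/\ coef_rec k c,
        forall c', coef_rec k c' -> forall a, in_A' k a -> c' a = c a
      & H_mpow k.+1
          (zeta -
           \sum_(a : bexp k | in_A' k (bval a))
             H_scale (c (bval a))
               (H_upow `|ea (bval a)|%N
                  (H_class (pham_F m R) (cps_mono R (xs (ra (bval a)) (bval a))))))].
Proof.
have [c crec] := @coef_rec_exists R n m k; exists c; split=> //.
  by move=> c' c'rec; exact: coef_rec_uniq.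
rewrite -/(candidate k c); set delta := zeta - _.
have delta_low l : (size l <= k)%N ->
    low (-1) (G_restr (pham_f m R) (G_dss l (H_incl delta))).
  move=> lk; rewrite H_inclB G_dssB (G_restrB (restr_pham R m)).
  have [->|l0] := eqVneq l [::].
    by rewrite /= restr_primitive0 // restr_candidate0 // subrr; exact: low0.
  by apply: lowD; [exact: primitive_low|apply: lowN; exact: candidate_low].
suff H j : (j <= k.+1)%N -> exists2 g : gps R (vars n (Gam m)),
    \pi_(brieskorn (pham_F m R)) g = delta & s_order j g.
  by have [g <- gk] := H k.+1 (leqnn _); exact: s_order_mpow.
elim: j => [_|j IH jk]; first by exists (repr delta); rewrite ?reprK.
have [g gE gj] := IH (ltnW jk).
have [|g' g'E g'j] := s_order_step (restr_pham R m) gj; last first.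
  by exists g'; rewrite ?g'E.
move=> a aj; apply: (lattice_opposite hm).
have [l lE] := content_surj a.
have lj : size l = j by rewrite -edeg_content lE.
have := delta_low l; rewrite lj => /(_ jk).
rewrite -gE H_inclE G_dssE (G_restrE (restr_pham R m)).
have -> : lps_restr (nablas (pham_F m R) l (lps_incl g)) =
    (efact a)%:R *: lps_incl (gps_slice a g).
  apply/val_inj/funext => e; apply/funext => i.
  rewrite [LHS](_ : _ = nablas (pham_F m R) l (lps_incl g) (xs (xpart e) ezero) i) //.
  by rewrite restr_nablas ?lE // lj.
move=> /(low_scale hm (efact a)%:R^-1); rewrite scalerA mulVf ?scale1r //.
by rewrite pnatr_eq0 -lt0n /efact prodn_gt0 // => nu; rewrite fact_gt0.
Qed.
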